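(* Let $\mathcal{L}=(n,\mathcal{M},\mathcal{C})$ be a simple linearization and let $\mathcal{T}\subseteq\mathcal{P}$ be a subset of its proper monomials. Then $\mathrm{proj}_{\mathcal{S}\cup\mathcal{T}}(P(\mathcal{L}))$ is an integral polytope if and only if the digraph $D(\mathcal{L})$ does not contain a subgraph $Z$ such that (a) the undirected graph $G(Z)$ is a cycle, and (b) $V(Z)\subseteq \mathrm{succ}(\mathcal{T})$. Moreover, if this projection is integral and $\mathcal{P}\subseteq\mathrm{succ}(\mathcal{T})$, then the inequality system (i)–(iii) defining $P(\mathcal{L})$ is totally dual integral.
   Context: Fix a positive integer $n$, $[n]=\{1,\dots,n\}$. A monomial is a nonempty subset $m\subseteq[n]$; $\mathcal{S}=\{\{i\}: i\in[n]\}$ are the singleton monomials. A linearization is a triple $\mathcal{L}=(n,\mathcal{M},\mathcal{C})$, where $\mathcal{M}$ is a set of monomials with $\mathcal{S}\subseteq\mathcal{M}$, and $\mathcal{C}$ is a set of AND-constraints; each AND-constraint is a set $c=\{m_1,\dots,m_k\}\subseteq\mathcal{M}$ whose union $\bigcup c$ (its resultant) lies in $\mathcal{M}$. The proper monomials are $\mathcal{P}=\mathcal{M}\setminus\mathcal{S}$. Linearizations are assumed consistent: for each $m\in\mathcal{P}$ there is $c\in\mathcal{C}$ with $\bigcup c=m$ and $|m'|<|m|$ for all $m'\in c$. $\mathcal{L}$ is simple if each proper monomial is the resultant of exactly one AND-constraint and $|\mathcal{C}|=|\mathcal{P}|$. The relaxation $P(\mathcal{L})\subseteq\mathbb{R}^{\mathcal{M}}$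 is the set of $y$ satisfying (i) $0\le y_m\le 1$ for all $m\in\mathcal{M}$; (ii) $y_{\bigcup c}\le y_m$ for all $c\in\mathcal{C}$, $m\in c$; (iii) $\sum_{m\in c}y_m\le y_{\bigcup c}+|c|-1$ for all $c\in\mathcal{C}$. For simple $\mathcal{L}$, the digraph $D(\mathcal{L})$ has node set $\mathcal{M}$ and, for each $c\in\mathcal{C}$, an arc from $\bigcup c$ to each $m\in c$. For a digraph $D$, $G(D)$ denotes its underlying undirected graph and $V(D)$ its node set; cycles are simple cycles. For a node set $W$, $\mathrm{succ}(W)$ is the set of nodes reachable by directed paths from some node of $W$, including $W$ itself. $\mathrm{proj}_{\mathcal{M}'}$ denotes orthogonal projection onto the coordinates indexed by $\mathcal{M}'\subseteq\mathcal{M}$. A system $Ax\le b$ (rational data) is totally dual integral (TDI) if for every integral objective $w$ for which $\max\{w^\top x: Ax\le b\}$ is finite, the dual $\min\{b^\top u: A^\top u=w,u\ge0\}$ has an integral optimal solution. *)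

(* Defs.v *)
From HB Require Import structures.
From mathcomp Require Import all_boot all_order all_algebra.
From mathcomp Require Import reals.

Set Implicit Arguments.
Unset Strict Implicit.
Unset Printing Implicit Defensive.

Import Order.TTheory GRing.Theory Num.Theory.
Local Open Scope ring_scope.

(* Monomials over [n] = 'I_n are sets {set 'I_n}; a set of monomials is a
   {set {set 'I_n}}; an AND-constraint is a {set {set 'I_n}} and its
   resultant is [cover c] (the union of its members); a set of
   AND-constraints is a {set {set {set 'I_n}}}. *)

Definition singletons (n : nat) : {set {set 'I_n}} := [set [set i] | i : 'I_n].

Definition proper_monos (n : nat) (M : {set {set 'I_n}}) : {set {set 'I_n}} :=
  M :\: singletons n.

Definition is_linearization (n : nat) (M : {set {set 'I_n}})
    (C : {set {set {set 'I_n}}}) : Prop :=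
  [/\ (forall m, m \in M -> m != set0),
      singletons n \subset M,
      (forall c, c \in C -> (c \subset M) /\ (cover c \in M)) &
      (forall m, m \in proper_monos M ->
         exists c, [/\ c \in C, cover c = m &
                      forall m', m' \in c -> #|m'| < #|m|]%N)].

Definition is_simple (n : nat) (M : {set {set 'I_n}})
    (C : {set {set {set 'I_n}}}) : Prop :=
  (forall m, m \in proper_monos M -> #|[set c in C | cover c == m]| = 1%N)
  /\ #|C| = #|proper_monos M|.

Definition arc (n : nat) (C : {set {set {set 'I_n}}}) : rel {set 'I_n} :=
  fun u v => [exists c in C, (cover c == u) && (v \in c)].

Definition succ (n : nat) (C : {set {set {set 'I_n}}}) (W : {set {set 'I_n}})
  : {set {set 'I_n}} :=
  [set v | [exists w in W, connect (arc C) w v]].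

Definition is_subgraph (n : nat) (M : {set {set 'I_n}})
    (C : {set {set {set 'I_n}}}) (VZ : {set {set 'I_n}}) (AZ : rel {set 'I_n})
  : Prop :=
  VZ \subset M /\
  (forall u v, AZ u v -> [&& arc C u v, u \in VZ & v \in VZ]).

Definition underlying_is_cycle (n : nat) (VZ : {set {set 'I_n}})
    (AZ : rel {set 'I_n}) : Prop :=
  exists s : seq {set 'I_n},
    [/\ uniq s, (3 <= size s)%N,
        (forall x, (x \in VZ) = (x \in s)) &
        (forall u v, u \in VZ -> v \in VZ ->
           (AZ u v || AZ v u) = ((next s u == v) || (next s v == u)))].

Section Poly.
Variable R : realType.
Variable n : nat.

(* vectors in R^I for I a set of monomials: functions vanishing outside I *)
Definition vec := {set 'I_n} -> R.
Definition supp_in (I : {set {set 'I_n}}) (y : vec) : Prop :=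
  forall m, m \notin I -> y m = 0.

(* Rows of the system (i)-(iii), written as a^T y <= b. *)
Definition rowT : finType :=
  (({set 'I_n} + {set 'I_n}) + ({set {set 'I_n}} * {set 'I_n} + {set {set 'I_n}}))%type.

Definition is_row (M : {set {set 'I_n}}) (C : {set {set {set 'I_n}}}) (r : rowT)
  : bool :=
  match r with
  | inl (inl m) => m \in M                 (* y_m <= 1 *)
  | inl (inr m) => m \in M                 (* - y_m <= 0 *)
  | inr (inl (c, m)) => (c \in C) && (m \in c)  (* y_{Uc} - y_m <= 0 *)
  | inr (inr c) => c \in C                 (* sum_{m in c} y_m - y_{Uc} <= |c|-1 *)
  end.

Definition rowA (r : rowT) (m' : {set 'I_n}) : R :=
  match r with
  | inl (inl m) => (m' == m)%:R
  | inl (inr m) => - (m' == m)%:R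
  | inr (inl (c, m)) => (m' == cover c)%:R - (m' == m)%:R
  | inr (inr c) => (m' \in c)%:R - (m' == cover c)%:R
  end.

Definition rowb (r : rowT) : R :=
  match r with
  | inl (inl _) => 1
  | inl (inr _) => 0
  | inr (inl _) => 0
  | inr (inr c) => (#|c|%:R - 1)
  end.

Definition feasible (M : {set {set 'I_n}}) (C : {set {set {set 'I_n}}}) (y : vec)
  : Prop :=
  forall r, is_row M C r -> \sum_(m in M) rowA r m * y m <= rowb r.

Definition PL (M : {set {set 'I_n}}) (C : {set {set {set 'I_n}}}) (y : vec) : Prop :=
  supp_in M y /\ feasible M C y.

Definition proj (I : {set {set 'I_n}}) (Q : vec -> Prop) (z : vec) : Prop :=
  exists2 y, Q y & forall m, z m = if m \in I then y m else 0.

Definition integral_vec (p : vec) : Prop := forall m, exists k : int, p m = k%:~R.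

Definition conv (s : seq vec) (z : vec) : Prop :=
  exists lam : 'I_(size s) -> R,
    [/\ (forall i, 0 <= lam i), \sum_i lam i = 1 &
        forall m, z m = \sum_i lam i * (nth (fun _ => 0) s i) m].

Definition integral_polytope (Q : vec -> Prop) : Prop :=
  exists s : seq vec, (forall i : 'I_(size s), integral_vec (nth (fun _ => 0) s i)) /\
                      (forall z, Q z <-> conv s z).

Definition TDI (M : {set {set 'I_n}}) (C : {set {set {set 'I_n}}}) : Prop :=
  forall w : {set 'I_n} -> int,
    let obj (x : vec) := \sum_(m in M) (w m)%:~R * x m in
    let dual_feas (u : rowT -> R) :=
      (forall r, is_row M C r -> 0 <= u r) /\
      (forall m, m \in M -> \sum_(r | is_row M C r) u r * rowA r m = (w m)%:~R) in
    let dual_obj (u : rowT -> R) := \sum_(r | is_row M C r) u r * rowb r in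
    (exists x, feasible M C x /\ forall x', feasible M C x' -> obj x' <= obj x) ->
    exists u : rowT -> int,
      dual_feas (fun r => (u r)%:~R) /\
      forall u', dual_feas u' -> dual_obj (fun r => (u r)%:~R) <= dual_obj u'.

End Poly.

(* Main.v *)
(**
  Only if.  Suppose two children of some monomial [x] below [T] share an
  element, or contain elements joined by a chain of monomials of [T] none of
  which lies above [x].  Let [L] be the set of all elements joined to them.  The
  point that is 1/2 on every monomial meeting [L], except for 0 on [x] and the
  monomials above it, and 1 elsewhere, satisfies the system; in any convex
  decomposition of its projection the chain forces the elements of [L] to be
  chosen all together or not at all, which contradicts the value 0 above [x].
  If no such [x] exists, every arc below [T] is a bridge: add the members of [T]
  one at a time; an arc from [m] to [a] that is new with [t] separates what is
  below or joined to [a] from the rest.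

  If and total dual integrality.  A forest is glued from single AND-constraints
  along single nodes.  A single AND-constraint has dual solutions matching some
  0/1 solution, integral for integral objectives, and this property survives
  gluing, because the optimal value of one part is an affine function of the
  shared variable with integral slope.  Over the integers this is total dual
  integrality; over the reals it gives integrality by Farkas' lemma.
*)
Require Import Defs.
From HB Require Import structures.
From mathcomp Require Import all_boot all_order all_algebra.
From mathcomp Require Import reals boolp.
From mathcomp Require Import lra.
Import Defs.

Set Implicit Arguments.
Unset Strict Implicit.
Unset Printing Implicit Defensive.

Import Order.TTheory GRing.Theory Num.Theory.
Local Open Scope ring_scope.

(** * Connectivity *)

Lemma connect_first (T : finType) (e : rel T) x y :
  connect e x y -> x = y \/ exists2 z, e x z & connect e z y.
Proof.
case/connectP=> -[|z p] /=; first by move=> _ ->; left.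
by case/andP=> xz zp ->; right; exists z => //; apply/connectP; exists p.
Qed.

Lemma connect_last (T : finType) (e : rel T) x y :
  connect e x y -> x = y \/ exists2 z, connect e x z & e z y.
Proof.
case/connectP=> p; case: (lastP p) => [|q z] /=; first by move=> _ ->; left.
rewrite rcons_path last_rcons => /andP[xq qz] ->; right.
by exists (last x q) => //; apply/connectP; exists q.
Qed.

Lemma connect_closed (T : finType) (e : rel T) (P : pred T) x y :
  (forall u v, e u v -> P u -> P v) -> connect e x y -> P x -> P y.
Proof.
move=> eP /connectP[p ep ->]; elim: p x ep => //= z p IH x /andP[xz zp] Px.
by apply: IH zp _; apply: eP xz Px.
Qed.

Lemma connect_sub_rel (T : finType) (e e' : rel T) x y :
  subrel e e' -> connect e x y -> connect e' x y.
Proof. by move=> ee'; apply: connect_sub => u v uv; apply/connect1/ee'. Qed.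

(* A cyclic sequence that leaves [x] towards [next s x] has to come back to
   [x] through the other steps. *)
Lemma cycle_return (T : eqType) (s : seq T) (P : pred T) (x : T) :
  uniq s -> (3 <= size s)%N -> x \in s ->
  (forall w, w \in s -> w != x -> (w, next s w) != (next s x, x) ->
     P w = P (next s w)) ->
  P (next s x) = P x.
Proof.
move=> us s3 xs stepP; have [i s1 eqs] := rot_to xs.
have ur : uniq (x :: s1) by rewrite -eqs rot_uniq.
have sz : size (x :: s1) = size s by rewrite -eqs size_rot.
have nE w : next s w = next (x :: s1) w by rewrite -eqs next_rot.
case: s1 => [|y [|z s2]] in eqs ur sz nE *; rewrite -sz // in s3.
have mE w : (w \in s) = (w \in [:: x, y, z & s2]) by rewrite -eqs mem_rot.
have nx : next s x = y by rewrite nE /= eqxx.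
have ny : next s y = z.
  rewrite nE /=; move: ur; rewrite /= inE negb_or => /andP[/andP[/negPf xy _] _].
  by rewrite eq_sym xy eqxx.
have zx : z != x.
  by move: ur => /andP[]; rewrite !inE !negb_or => /and3P[_ xz _] _;
     rewrite eq_sym.
pose e : rel T := fun w w' => (w != x) ==> (P w == P w').
have : cycle e [:: x, y, z & s2].
  apply: cycle_from_next => // w; rewrite -mE -nE => ws; apply/implyP=> wx.
  apply/eqP/stepP => //; rewrite nx; apply/eqP=> -[wy nwx].
  by move: nwx; rewrite wy ny => zx'; rewrite zx' eqxx in zx.
have back l v : x \notin v :: l -> path e v (rcons l x) -> P v = P x.
  elim: l v => [|w l IH] v; rewrite in_cons negb_or eq_sym => /andP[vx xl] /=.
    by rewrite /e vx andbT => /eqP.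
  by case/andP; rewrite /e vx => /eqP-> /(IH _ xl).
rewrite nx => /andP[_ pth]; apply: (back (z :: s2)) pth.
by case/andP: ur.
Qed.

(** * Elementary properties of simple linearizations *)

Section Linearization.
Variables (n : nat) (M : {set {set 'I_n}}) (C : {set {set {set 'I_n}}}).
Hypothesis linMC : is_linearization M C.
Hypothesis simMC : is_simple M C.
Implicit Types (c d : {set {set 'I_n}}) (m t u v a b : {set 'I_n}).
Implicit Types (T H : {set {set 'I_n}}).

Lemma proper_ex m : m \in proper_monos M -> exists2 c, c \in C & cover c = m.
Proof. by case: linMC => _ _ _ h /h[c [cC cm _]]; exists c. Qed.

(** By consistency every proper monomial is a resultant. Since [C] has only as many members as there
    are proper monomials, no other resultant fits, and no resultant is repeated. *)
Lemma cover_imset : @cover 'I_n @: C = proper_monos M.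
Proof.
apply/esym/eqP; rewrite eqEcard; apply/andP; split.
  by apply/subsetP=> m /proper_ex[c cC <-]; apply: imset_f.
by case: simMC => _ <-; apply: leq_imset_card.
Qed.

Lemma cover_proper c : c \in C -> cover c \in proper_monos M.
Proof. by move=> cC; rewrite -cover_imset imset_f. Qed.

Lemma cover_inj c d : c \in C -> d \in C -> cover c = cover d -> c = d.
Proof.
have /imset_injP inj : #|@cover 'I_n @: C| == #|C|.
  by rewrite cover_imset; case: simMC => _ ->.
exact: inj.
Qed.

Lemma cover_M c : c \in C -> cover c \in M.
Proof. by move/cover_proper; rewrite inE => /andP[]. Qed.

(** Consistency only promises some constraint with smaller members for this resultant; by
    injectivity of [cover] that constraint is [c]. *)
Lemma child_lt c m : c \in C -> m \in c -> (#|m| < #|cover c|)%N.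
Proof.
move=> cC mc; case: linMC => _ _ _ h.
have [d [dC dc]] := h _ (cover_proper cC).
by rewrite (cover_inj dC cC dc); apply.
Qed.

Lemma child_M c m : c \in C -> m \in c -> m \in M.
Proof. by case: linMC => _ _ h _ /h[/subsetP cM _] /cM. Qed.

Lemma mono_neq0 m : m \in M -> m != set0.
Proof. by case: linMC => h _ _ _ /h. Qed.

Lemma mono_ex m : m \in M -> exists i, i \in m.
Proof. by move/mono_neq0/set0Pn. Qed.

Lemma singleton_M (i : 'I_n) : [set i] \in M.
Proof.
by case: linMC => _ /subsetP sM _ _; apply: sM; apply/imsetP; exists i.
Qed.

Lemma cover_notin c : c \in C -> cover c \notin c.
Proof. by move=> cC; apply/negP=> /(child_lt cC); rewrite ltnn. Qed.

Lemma constraint_ex c : c \in C -> exists m, m \in c.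
Proof.
move=> cC; have [i /bigcupP[m mc _]] := mono_ex (cover_M cC).
by exists m.
Qed.

Lemma arcP (K : {set {set {set 'I_n}}}) u v :
  reflect (exists c, [/\ c \in K, cover c = u & v \in c]) (arc K u v).
Proof.
apply: (iffP existsP) => [[c /and3P[cK /eqP cu vc]]|[c [cK cu vc]]]; exists c.
  by split.
by rewrite cK vc cu eqxx.
Qed.

Lemma arc_sub u v : arc C u v -> v \subset u.
Proof. by case/arcP=> c [_ <- vc]; apply: bigcup_sup. Qed.

Lemma arc_lt u v : arc C u v -> (#|v| < #|u|)%N.
Proof. by case/arcP=> c [cC <- vc]; apply: child_lt. Qed.

Lemma arc_Ml u v : arc C u v -> u \in M.
Proof. by case/arcP=> c [cC <- _]; apply: cover_M. Qed.

Lemma arc_Mr u v : arc C u v -> v \in M.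
Proof. by case/arcP=> c [cC _]; apply: child_M. Qed.

Lemma arc_mem u v c : c \in C -> cover c = u -> arc C u v -> v \in c.
Proof. by move=> cC cu /arcP[d [dC du]]; rewrite (cover_inj cC dC) // cu. Qed.

Lemma connect_sub_mono u v : connect (arc C) u v -> v \subset u.
Proof.
move=> uv; pose P : pred {set 'I_n} := fun w => w \subset u.
have clP x y : arc C x y -> P x -> P y by move/arc_sub; apply: subset_trans.
exact: connect_closed clP uv (subxx u).
Qed.

Lemma arc_irrefl_connect u v : arc C u v -> ~~ connect (arc C) v u.
Proof.
move=> uv; apply/negP=> /connect_sub_mono/subset_leq_card.
by rewrite leqNgt arc_lt.
Qed.

Lemma arc_ex u i : u \in proper_monos M -> i \in u ->
  exists2 v, arc C u v & i \in v.
Proof.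
case/proper_ex=> c cC <- /bigcupP[v vc iv]; exists v => //.
by apply/arcP; exists c.
Qed.

Lemma succP T v :
  reflect (exists2 t, t \in T & connect (arc C) t v) (v \in succ C T).
Proof.
rewrite inE; apply: (iffP existsP) => [[t /andP[]]|[t tT tv]]; exists t => //.
by rewrite tT.
Qed.

Lemma succ_connect T u v : u \in succ C T -> connect (arc C) u v -> v \in succ C T.
Proof.
case/succP=> t tT tu uv; apply/succP; exists t => //; exact: connect_trans tu uv.
Qed.

Lemma succ_arc T u v : u \in succ C T -> arc C u v -> v \in succ C T.
Proof. by move=> uT uv; apply: succ_connect uT (connect1 uv). Qed.

(** * Arborescences below a monomial *)

(** Under this condition the nodes below [t] form a laminar family, and the digraph below [t] is an
    arborescence. *)
Definition disjoint_below t := forall u a b i,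
  connect (arc C) t u -> arc C u a -> arc C u b -> i \in a -> i \in b -> a = b.

Lemma disjoint_belowW t u :
  connect (arc C) t u -> disjoint_below t -> disjoint_below u.
Proof. by move=> tu dt v a b i uv; apply: dt; apply: connect_trans tu uv. Qed.

(** If neither node is [t], both lie below children of [t] containing [i]. These children coincide,
    and the induction continues in the common child. *)
Lemma below_comparable t u v i : disjoint_below t ->
  connect (arc C) t u -> connect (arc C) t v -> i \in u -> i \in v ->
  connect (arc C) u v || connect (arc C) v u.
Proof.
elim/ltn_ind: {t}#|t| {-2}t (erefl #|t|) => k IH t tk dt tu tv iu iv.
have [tE|[a ta au]] := connect_first tu; first by rewrite -tE tv.
have [tE|[b tb bv]] := connect_first tv; first by rewrite -tE tu orbT.
have ab : a = b.
  apply: (dt t a b i) => //; first exact: (subsetP (connect_sub_mono au)).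
  exact: (subsetP (connect_sub_mono bv)).
apply: (IH #|a| _ a) => //; rewrite -?tk ?arc_lt ?ab //.
by apply: disjoint_belowW dt; apply: connect1.
Qed.

(** Two parents of [v] share an element of [v], so they are comparable. If one were strictly above
    the other, its child towards the other would meet [v], hence be [v], and an arc would go back
    up. *)
Lemma below_unique_parent t p q v : disjoint_below t ->
  connect (arc C) t p -> connect (arc C) t q -> arc C p v -> arc C q v -> p = q.
Proof.
move=> dt tp tq pv qv; have [i iv] := mono_ex (arc_Mr pv).
have inc x : arc C x v -> i \in x by move/arc_sub/subsetP; apply.
have onedir x y : connect (arc C) t x -> arc C x v -> arc C y v ->
    connect (arc C) x y -> x = y.
  move=> tx xv yv /connect_first[//|[w xw wy]].
  have wv : w = v.
    apply: (dt x _ _ i) => //.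
    exact: (subsetP (connect_sub_mono wy)) (inc _ yv).
  by move: (arc_irrefl_connect yv); rewrite -wv wy.
case/orP: (below_comparable dt tp tq (inc _ pv) (inc _ qv)).
  exact: onedir.
by move/onedir=> h; apply/esym/h.
Qed.

(** Walk down from [t] as long as one child contains both elements. The walk ends before a
    singleton, which cannot contain two elements. *)
Lemma below_separator t i j : t \in M -> disjoint_below t ->
  i \in t -> j \in t -> i != j ->
  exists u a b, [/\ connect (arc C) t u, arc C u a, arc C u b &
                    [/\ a != b, i \in a & j \in b]].
Proof.
elim/ltn_ind: {t}#|t| {-2}t (erefl #|t|) => k IH t tk tM dt it jt ij.
have tP : t \in proper_monos M.
  rewrite inE tM andbT; apply/imsetP=> -[l _ tl].
  by move: it jt ij; rewrite tl !inE => /eqP-> /eqP->; rewrite eqxx.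
have [a ta ia] := arc_ex tP it; have [b tb jb] := arc_ex tP jt.
have [ab|ab] := eqVneq a b; last by exists t, a, b; rewrite connect0.
have [|||||||u [a' [b' [au ua ub h]]]] := IH #|a| _ a => //.
- by rewrite -tk arc_lt.
- exact: arc_Mr ta.
- by apply: disjoint_belowW dt; apply: connect1.
- by rewrite ab.
- by exists u, a', b'; split=> //; apply: connect_trans (connect1 ta) au.
Qed.

(** * Separated but linked elements *)

Definition link H : rel 'I_n := fun i j => [exists t in H, (i \in t) && (j \in t)].

Lemma linkP H i j :
  reflect (exists t, [/\ t \in H, i \in t & j \in t]) (link H i j).
Proof.
apply: (iffP existsP) => [[t /and3P[tH it jt]]|[t [tH it jt]]]; exists t.
  by split.
by rewrite tH it jt.
Qed.

Definition avoiding T m := [set t in T | ~~ connect (arc C) t m].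

(* The obstruction to integrality: two children of [m] are tied together,
   either by a common element or by monomials of [T] that do not use [m]. *)
Definition linked_children T m := exists a b i j,
  [/\ arc C m a, arc C m b, a != b, i \in a & j \in b] /\
  connect (link (avoiding T m)) i j.

(** * Without linked children there is no cycle *)

Section NoLinkedChildren.
Variable T : {set {set 'I_n}}.
Hypothesis TM : T \subset M.
Hypothesis nolink : forall m, m \in succ C T -> ~ linked_children T m.

Lemma unlinked_disjoint_below t : t \in T -> disjoint_below t.
Proof.
move=> tT u a b i tu ua ub ia ib; apply/eqP/negPn/negP=> ab.
apply: (nolink (m := u)); first by apply/succP; exists t.
by exists a, b, i, i; rewrite connect0.
Qed.

Section Bridge.
Variables (t : {set 'I_n}) (T2 : {set {set 'I_n}}) (m a : {set 'I_n}).
Hypotheses (tT : t \in T) (T2T : T2 \subset T).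
Hypotheses (tm : connect (arc C) t m) (mT2 : m \notin succ C T2).
Hypothesis (ma : arc C m a).

Definition reached j := [exists i in a, connect (link T2) i j].

(** One side of the cut made by deleting the arc from [m] to [a]. An old node, that is, one below
    [T2], belongs to it as soon as links of [T2] join it to [a]. The lemmas below show that no other
    arc crosses the cut. *)
Definition bridge_side v :=
  connect (arc C) a v || (v \in succ C T2) && [exists j in v, reached j].

Let dt := unlinked_disjoint_below tT.
Let ta : connect (arc C) t a := connect_trans tm (connect1 ma).

Lemma bridge_side_start : bridge_side a.
Proof. by rewrite /bridge_side connect0. Qed.

Lemma bridge_side_end : ~~ bridge_side m.
Proof. by rewrite /bridge_side (negPf mT2) orbF arc_irrefl_connect. Qed.

Lemma bridge_side_sub v i : connect (arc C) a v -> i \in v -> reached i.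
Proof.
move=> av iv; apply/existsP; exists i; rewrite connect0 andbT.
exact: (subsetP (connect_sub_mono av)).
Qed.

(** A member of [T2] above [u] contains [u] and [v] and thus links all their elements, so one of
    them is reached exactly when the other is. *)
Lemma bridge_side_old u v : u \in succ C T2 -> arc C u v ->
  bridge_side u = bridge_side v.
Proof.
move=> uT2 uv; have vT2 := succ_arc uT2 uv.
have [j jv] := mono_ex (arc_Mr uv); have vu := subsetP (arc_sub uv).
apply/idP/idP; rewrite /bridge_side uT2 vT2 /=.
  case/orP=> [au|]; first by rewrite (connect_trans au (connect1 uv)).
  case/existsP=> k /andP[ku /existsP[i /andP[ia ik]]].
  apply/orP; right; apply/existsP; exists j; rewrite jv /=.
  apply/existsP; exists i; rewrite ia /=; apply: connect_trans ik (connect1 _).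
  case/succP: uT2 => s sT2 /connect_sub_mono/subsetP us.
  by apply/linkP; exists s; split=> //; apply: us => //; apply: vu.
case/orP=> [av|/existsP[k /andP[kv rk]]]; apply/orP; right; apply/existsP.
  by exists j; rewrite (vu _ jv) (bridge_side_sub av).
by exists k; rewrite vu.
Qed.

(** As [u] is new, it is on the side of [a] only when below [a]. If [v] is below [a], unique parents
    put [u] there too. If [v] is merely reached, the node where [v] and [a] branch apart has linked
    children. *)
Lemma bridge_side_tree u v : connect (arc C) t u -> u \notin succ C T2 ->
  arc C u v -> (u, v) != (m, a) -> bridge_side u = bridge_side v.
Proof.
move=> tu uT2 uv neq; have tv := connect_trans tu (connect1 uv).
rewrite {1}/bridge_side (negPf uT2) orbF.
apply/idP/idP=> [au|]; first by rewrite /bridge_side (connect_trans au (connect1 uv)).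
case: (boolP (connect (arc C) a v)) => [av _|nav].
  case/connect_last: (av) => [av'|[p ap pv]].
    move: neq; rewrite -av' in uv *.
    by rewrite (below_unique_parent dt tu tm uv ma) eqxx.
  by rewrite (below_unique_parent dt tu (connect_trans ta ap) uv pv).
rewrite /bridge_side (negPf nav) /= => /andP[vT2].
case/existsP=> j /andP[jv /existsP[i /andP[ia ij]]].
(* A path from [v] to [a] would enter [a] through its only parent [m], making [m] old. *)
have nva : ~~ connect (arc C) v a.
  apply/negP=> /connect_last[va|[p vp pa]]; first by rewrite va connect0 in nav.
  case/negP: mT2; apply: succ_connect vT2 _.
  by rewrite (below_unique_parent dt tm (connect_trans tv vp) ma pa).
have ja : j \notin a.
  apply/negP=> ja; move: (below_comparable dt ta tv ja jv).
  by rewrite (negPf nav) (negPf nva).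
have neqij : i != j by apply: contraNneq ja => <-.
have tM : t \in M by apply: (subsetP TM).
have it : i \in t := subsetP (connect_sub_mono ta) _ ia.
have jt : j \in t := subsetP (connect_sub_mono tv) _ jv.
have [x [a' [b' [tx xa xb [ab ia' jb']]]]] := below_separator tM dt it jt neqij.
have ix : i \in x := subsetP (arc_sub xa) _ ia'.
have jx : j \in x := subsetP (arc_sub xb) _ jb'.
have im : i \in m := subsetP (arc_sub ma) _ ia.
have nax : ~~ connect (arc C) a x.
  by apply: contraNN ja => /connect_sub_mono/subsetP; apply.
(* [x] and [m] share [i]. Were [x] strictly below [m], it would lie below the child [a], which does
   not contain [j]. *)
have xm : connect (arc C) x m.
  case/orP: (below_comparable dt tx tm ix im) => // /connect_first[->//|[w mw wx]].
  move: nax; rewrite (dt tm ma mw ia) ?wx //.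
  exact: (subsetP (connect_sub_mono wx)).
(* Hence no member of [T2] lies above [x], and the chain from [i] to [j] avoids [x]. *)
have xT2 : x \notin succ C T2.
  by apply: contraNN mT2 => xT2; apply: succ_connect xT2 xm.
case: (nolink (m := x)); first by apply/succP; exists t.
exists a', b', i, j; split=> //.
apply: connect_sub_rel ij => k l /linkP[s [sT2 ks ls]].
apply/linkP; exists s; split=> //; rewrite inE (subsetP T2T) //=.
by apply: contraNN xT2 => sx; apply/succP; exists s.
Qed.

End Bridge.

(** Induction on the size of [T']: a cycle below [T'] that is not below [T' :\ t] uses an arc with a
    new tail. That arc crosses the cut [bridge_side] and no other arc does, whereas [cycle_return]
    says a cycle cannot cross a cut only once. *)
Lemma unlinked_acyclic VZ (AZ : rel {set 'I_n}) :
  is_subgraph M C VZ AZ -> underlying_is_cycle VZ AZ ->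
  ~~ (VZ \subset succ C T).
Proof.
case=> _ subAZ [s [us s3 VZs cyc]].
have arcAZ u v : AZ u v -> arc C u v by case/subAZ/and3P.
suff main k T' : #|T'| = k -> T' \subset T -> ~~ (VZ \subset succ C T') by exact: main.
elim: k T' => [|k IH] T' cT' T'T; apply/negP=> /subsetP sZ.
  case: s s3 VZs {us cyc} => // x s _ VZs.
  have /sZ/succP[t] : x \in VZ by rewrite VZs inE eqxx.
  by rewrite (cards0_eq cT') inE.
have [t tT'] : exists t, t \in T' by apply/set0Pn; rewrite -card_gt0 cT'.
have tT : t \in T := subsetP T'T t tT'.
have T2T : T' :\ t \subset T by apply: subset_trans T'T; apply: subD1set.
have cT2 : #|T' :\ t| = k by move: cT'; rewrite (cardsD1 t) tT' => -[].
have /subsetPn[x xZ xT2] := IH _ cT2 T2T.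
have nZ w : w \in VZ -> next s w \in VZ by rewrite !VZs mem_next.
have edge w : w \in VZ -> arc C w (next s w) \/ arc C (next s w) w.
  move=> wZ; move: (cyc _ _ wZ (nZ _ wZ)); rewrite eqxx /=.
  by case/orP=> /arcAZ; [left|right].
have in_t w : w \in VZ -> w \notin succ C (T' :\ t) -> connect (arc C) t w.
  move=> /sZ/succP[t' t'T' t'w] /succP nw; have [<- //|tt'] := eqVneq t' t.
  by case: nw; exists t' => //; rewrite !inE tt'.
have stay m a : connect (arc C) t m -> m \notin succ C (T' :\ t) -> arc C m a ->
    forall u v, u \in VZ -> arc C u v -> (u, v) != (m, a) ->
    bridge_side (T' :\ t) a u = bridge_side (T' :\ t) a v.
  move=> tm mT2 ma u v uZ uv neq.
  case: (boolP (u \in succ C (T' :\ t))) => uT2.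
    exact: bridge_side_old uT2 uv.
  exact: (bridge_side_tree tT T2T tm mT2 ma (in_t _ uZ uT2) uT2 uv neq).
have xs : x \in s by rewrite -VZs.
(* In either direction the arc between [x] and its successor has a new tail: [x], or else
   [next s x], because everything below an old node is old. *)
have [xn|nx] := edge _ xZ.
  have st := stay _ _ (in_t _ xZ xT2) xT2 xn.
  have := @cycle_return _ s (bridge_side (T' :\ t) (next s x)) x us s3 xs.
  rewrite bridge_side_start (negPf (bridge_side_end xT2 xn)) => h.
  have : true = false; last by [].
  apply: h => w; rewrite -VZs => wZ wx neq.
  have [wn|nw] := edge _ wZ; first by apply: st => //; apply: contraNneq wx => -[->].
  apply/esym/st => //; first exact: nZ.
  by apply: contraNneq neq => -[-> ->].
have nT2 : next s x \notin succ C (T' :\ t).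
  by apply: contraNN xT2 => h; apply: succ_arc h nx.
have st := stay _ _ (in_t _ (nZ _ xZ) nT2) nT2 nx.
have := @cycle_return _ s (bridge_side (T' :\ t) x) x us s3 xs.
rewrite bridge_side_start (negPf (bridge_side_end nT2 nx)) => h.
have : false = true; last by [].
apply: h => w; rewrite -VZs => wZ wx neq.
have [wn|nw] := edge _ wZ; first exact: st.
apply/esym/st => //; first exact: nZ.
by apply: contraNneq wx => -[_ ->].
Qed.

End NoLinkedChildren.
End Linearization.

(** Fill the indices greedily, each up to its bound. No division occurs, so integers are split into
    integers. *)
Lemma split_amount (D : realDomainType) (I : finType) (A : {set I}) (b : I -> D) (s : D) :
  (forall i, 0 <= b i) -> 0 <= s -> s <= \sum_(i in A) b i ->
  exists2 l : I -> D, (forall i, 0 <= l i <= b i) & \sum_(i in A) l i = s.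
Proof.
move=> b0; have [k] := ubnP #|A|; elim: k A s => // k IH A s cA s0 sb.
have [A0|[x xA]] := set_0Vmem A.
  exists (fun=> 0) => [i|]; first by rewrite lexx b0.
  by rewrite big1 //; move: sb; rewrite A0 big_set0; lra.
pose lx := Num.min (b x) s.
have lx0 : 0 <= lx by rewrite le_min b0.
have lxb : lx <= b x by rewrite ge_min lexx.
have lxs : lx <= s by rewrite ge_min lexx orbT.
have sum0 : 0 <= \sum_(i in A :\ x) b i by rewrite sumr_ge0.
have [|||l lb ls] := IH (A :\ x) (s - lx).
- by move: cA; rewrite (cardsD1 x) xA.
- by rewrite subr_ge0.
- move: sb; rewrite (big_setD1 x xA) /= /lx.
  by case: (leP (b x) s); move: sum0; set S := \sum_(i in A :\ x) b i; lra.
exists (fun i => if i == x then lx else l i) => [i|].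
  by case: eqP => [->|//]; rewrite lx0.
rewrite (big_setD1 x xA) /= eqxx.
rewrite (eq_bigr l) => [|i]; first by rewrite ls addrC subrK.
by rewrite !inE => /andP[/negPf->].
Qed.

(** * Acyclic systems of AND-constraints *)

Section Forest.
Variables (n : nat) (M : {set {set 'I_n}}) (C : {set {set {set 'I_n}}}).
Hypothesis linMC : is_linearization M C.
Hypothesis simMC : is_simple M C.
Implicit Types (c d : {set {set 'I_n}}) (m t u v x : {set 'I_n}).
Implicit Types (a : {set {set 'I_n}}) (K : {set {set {set 'I_n}}}).

Definition acyclic_in (V : {set {set 'I_n}}) := ~ (exists VZ AZ,
  [/\ is_subgraph M C VZ AZ, underlying_is_cycle VZ AZ & VZ \subset V]).

Definition adjacent K : rel {set 'I_n} := fun u v => arc K u v || arc K v u.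

Lemma adjacent_sym K : symmetric (adjacent K).
Proof. by move=> u v; rewrite /adjacent orbC. Qed.

Lemma adjacentW K K' : K \subset K' -> subrel (adjacent K) (adjacent K').
Proof.
move=> KK' u v; rewrite /adjacent => /orP[]/arcP[c [cK cu vc]]; apply/orP;
  [left|right]; apply/arcP; exists c; split=> //; exact: (subsetP KK').
Qed.

Lemma adjacent_cover K c m : c \in K -> m \in c -> adjacent K (cover c) m.
Proof. by move=> cK mc; apply/orP; left; apply/arcP; exists c. Qed.

Section Acyclic.
Variables (T : {set {set 'I_n}}).
Hypothesis acyc : acyclic_in (succ C T).

Definition constraints_below := [set c in C | cover c \in succ C T].

Lemma no_adjacent_cycle (s : seq {set 'I_n}) :
  uniq s -> (3 <= size s)%N -> cycle (adjacent constraints_below) s -> False.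
Proof.
move=> us s3 cs; apply: acyc.
have arcB u v : arc constraints_below u v ->
    [/\ arc C u v, u \in succ C T & v \in succ C T].
  case/arcP=> c [cB cu vc]; move: cB; rewrite inE => /andP[cC cT].
  have uv : arc C u v by apply/arcP; exists c.
  by rewrite cu in cT; split=> //; apply: succ_arc cT uv.
have adjs u : u \in s -> adjacent constraints_below u (next s u).
  exact: next_cycle.
have sV u : u \in s -> u \in succ C T.
  by move/adjs/orP=> [/arcB[]|/arcB[]].
have sM u : u \in s -> u \in M.
  move/adjs/orP=> [/arcB[uv _ _]|/arcB[uv _ _]].
    exact: (arc_Ml linMC simMC uv).
  exact: (arc_Mr linMC uv).
(* Only arcs between cyclically consecutive nodes are kept; a chord would spoil the underlying
   cycle. *)
exists [set x in s], (fun u v => [&& arc C u v, u \in s, v \in s &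
                        (next s u == v) || (next s v == u)]); split.
- split; first by apply/subsetP=> u; rewrite inE => /sM.
  by move=> u v /and4P[uv us' vs _]; rewrite uv !inE us' vs.
- exists s; split=> // [x|u v]; first by rewrite inE.
  rewrite !inE => us' vs; rewrite us' vs /=.
  rewrite [(next s v == u) || _]orbC -andb_orl; apply: andb_idl => nuv.
  have : adjacent constraints_below u v.
    case/orP: nuv => /eqP<-; first exact: adjs.
    by rewrite adjacent_sym adjs.
  by case/orP=> /arcB[->]; rewrite ?orbT.
- by apply/subsetP=> u; rewrite inE => /sV.
Qed.

(** A path avoiding [c] between two nodes of its star closes to a cycle through [cover c]. The case
    where one end is [cover c] comes first; it ensures that a path between two children misses
    [cover c]. *)
Lemma star_separated K c u v : K \subset constraints_below -> c \in K ->
  u \in cover c |: c -> v \in cover c |: c ->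
  connect (adjacent (K :\ c)) u v -> u = v.
Proof.
move=> KB cK; set e := adjacent (K :\ c).
have cC : c \in C by move/subsetP: KB => /(_ _ cK); rewrite inE => /andP[].
have eB : subrel e (adjacent constraints_below).
  by apply: adjacentW; apply: subset_trans KB; apply: subD1set.
have eC d : d \in K :\ c -> d \in C.
  by rewrite !inE => /andP[_] /(subsetP KB); rewrite inE => /andP[].
have topB x : x \in c -> adjacent constraints_below (cover c) x.
  by apply: adjacent_cover; apply: (subsetP KB).
have csym : connect_sym e by apply/sym_connect_sym/adjacent_sym.
have top x : x \in c -> ~~ connect e (cover c) x.
  move=> xc; apply/negP=> /connectP[p ep xE].
  case/shortenP: ep xE => {}p ep up _ xE.
  apply: (@no_adjacent_cycle (cover c :: p)) => //.
    case: p ep {up} xE => [_ /= xE|y [|//]].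
      by move: (cover_notin linMC simMC cC); rewrite -xE xc.
    (* A single edge would not give three nodes. It is impossible: downwards it needs a second
       constraint with resultant [cover c], upwards it contradicts the sizes. *)
    rewrite /= andbT => + yE; rewrite -yE => /orP[]/arcP[d [dK du vd]].
      have := dK; rewrite (cover_inj linMC simMC (eC _ dK) cC du).
      by rewrite !inE eqxx.
    have := child_lt linMC simMC (eC _ dK) vd; rewrite du => lt1.
    have := child_lt linMC simMC cC xc => lt2.
    by have := ltn_trans lt1 lt2; rewrite (ltnn #|cover c|).
  rewrite /= rcons_path -xE adjacent_sym topB // andbT.
  exact: sub_path ep.
rewrite !inE => /orP[/eqP->|uc] /orP[/eqP->|vc] //; first by move/negP: (top _ vc).
  by rewrite csym; move/negP: (top _ uc).
case/connectP=> p ep vE; case/shortenP: ep vE => {}p ep up _ vE.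
apply/eqP/negPn/negP=> uv; apply: (@no_adjacent_cycle [:: cover c, u & p]).
- rewrite cons_uniq up andbT; apply/negP=> /(path_connect ep).
  by rewrite csym (negPf (top _ uc)).
- by case: p ep up vE => //= _ _ /esym/eqP; rewrite (negPf uv).
- rewrite /= topB //= rcons_path -vE adjacent_sym topB // andbT.
  exact: sub_path ep.
Qed.

End Acyclic.

(** * Dual certificates *)

(** Integer copies of the rows let the certificates live over any ordered domain: over [int] they
    yield total dual integrality, over [R] integrality of the projection. *)
Definition rowAz (r : rowT n) (m' : {set 'I_n}) : int :=
  match r with
  | inl (inl m) => (m' == m)%:R
  | inl (inr m) => - (m' == m)%:R
  | inr (inl (c, m)) => (m' == cover c)%:R - (m' == m)%:R
  | inr (inr c) => (m' \in c)%:R - (m' == cover c)%:R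
  end.

Definition rowbz (r : rowT n) : int :=
  match r with
  | inl (inl _) => 1
  | inl (inr _) => 0
  | inr (inl _) => 0
  | inr (inr c) => #|c|%:R - 1
  end.

Definition solution K a := [forall c in K, (cover c \in a) == (c \subset a)].

Lemma solutionP K a :
  reflect (forall c, c \in K -> (cover c \in a) = (c \subset a)) (solution K a).
Proof.
apply: (iffP forallP) => [h c cK|h c]; first by move: (h c); rewrite cK => /eqP.
by apply/implyP=> cK; rewrite h.
Qed.

Definition nodes K := [set m | [exists c in K, (m == cover c) || (m \in c)]].

Lemma nodesP K m :
  reflect (exists2 c, c \in K & m \in cover c |: c) (m \in nodes K).
Proof.
rewrite inE; apply: (iffP existsP) => [[c /andP[cK h]]|[c cK]].
  by exists c; rewrite ?inE.
by rewrite !inE => h; exists c; rewrite cK.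
Qed.

Lemma eq_solution K a a' :
  (forall m, m \in nodes K -> (m \in a) = (m \in a')) ->
  solution K a -> solution K a'.
Proof.
move=> eqa /solutionP sa; apply/solutionP=> c cK.
have inK m : m \in cover c |: c -> (m \in a) = (m \in a').
  by move=> mc; apply: eqa; apply/nodesP; exists c.
rewrite -inK ?setU11 // sa //; apply/subsetP/subsetP => h m mc.
  by rewrite -inK ?h // !inE mc orbT.
by rewrite inK ?h // !inE mc orbT.
Qed.

Section Certificates.
Variable D : realDomainType.
Implicit Types (w l : {set 'I_n} -> D).

Definition value w a : D := \sum_(m in M | m \in a) w m.

(* A dual solution for the objective [w] whose value is at most that of the
   0/1 point [a]; when [a] is feasible both are optimal. *)
Definition certified a w := exists2 u : rowT n -> D, (forall r, 0 <= u r) &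
  (forall m, m \in M -> \sum_(r | is_row M C r) u r * (rowAz r m)%:~R = w m) /\
  \sum_(r | is_row M C r) u r * (rowbz r)%:~R <= value w a.

Lemma eq_value w w' a : (forall m, m \in M -> w m = w' m) -> value w a = value w' a.
Proof. by move=> ww'; apply: eq_bigr => m /andP[mM _]; apply: ww'. Qed.

Lemma valueD w w' a : value (fun m => w m + w' m) a = value w a + value w' a.
Proof. exact: big_split. Qed.

Lemma eq_certified a w w' :
  (forall m, m \in M -> w m = w' m) -> certified a w -> certified a w'.
Proof.
move=> ww' [u u0 [uA ub]]; exists u => //; split=> [m mM|].
  by rewrite uA // ww'.
by rewrite -(eq_value _ ww').
Qed.

Lemma certifiedW a a' w :
  value w a <= value w a' -> certified a w -> certified a' w.
Proof.
by move=> le [u u0 [uA ub]]; exists u => //; split=> //; apply: le_trans ub le.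
Qed.

Lemma certifiedD a w w' :
  certified a w -> certified a w' -> certified a (fun m => w m + w' m).
Proof.
move=> [u u0 [uA ub]] [u' u'0 [uA' ub']]; exists (fun r => u r + u' r).
  by move=> r; rewrite addr_ge0.
split=> [m mM|].
  by under eq_bigr do rewrite mulrDl; rewrite big_split /= uA // uA'.
by under eq_bigr do rewrite mulrDl; rewrite big_split /= valueD lerD.
Qed.

Lemma certified_sum a (I : Type) (r : seq I) (P : pred I) (f : I -> {set 'I_n} -> D) :
  (forall i, P i -> certified a (f i)) ->
  certified a (fun m => \sum_(i <- r | P i) f i m).
Proof.
move=> cf; elim: r => [|i r IH].
  exists (fun=> 0) => //; split=> [m mM|].
    by rewrite big_nil big1 // => r _; rewrite mul0r.
  rewrite big1 => [|r _]; last by rewrite mul0r.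
  by rewrite /value sumr_ge0 // => m _; rewrite big_nil.
have [Pi|Pi] := boolP (P i).
  apply: eq_certified (certifiedD (cf _ Pi) IH) => m _.
  by rewrite big_cons Pi.
by apply: eq_certified IH => m _; rewrite big_cons (negPf Pi).
Qed.

(** Complementary slackness for one row: a nonzero multiplier is allowed only where the 0/1 point
    attains the right-hand side. *)
Lemma certified_row a r (l : D) : is_row M C r -> 0 <= l ->
  (l != 0 -> rowbz r <= \sum_(m in M | m \in a) rowAz r m) ->
  certified a (fun m => l * (rowAz r m)%:~R).
Proof.
move=> rr l0 tr; exists (fun r' => if r' == r then l else 0) => [r'|].
  by case: eqP.
have pick (f : rowT n -> D) :
    \sum_(r' | is_row M C r') (if r' == r then l else 0) * f r' = l * f r.
  rewrite (bigD1 r) //= eqxx big1 ?addr0 // => r' /andP[_ /negPf->].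
  by rewrite mul0r.
split=> [m _|]; first exact: pick.
rewrite pick /value -mulr_sumr; have [->|ln0] := eqVneq l 0; first by rewrite !mul0r.
by rewrite ler_wpM2l // -rmorph_sum ler_int tr.
Qed.

Lemma sum_eq1 a m : m \in M ->
  \sum_(m' in M | m' \in a) (m' == m)%:R = (m \in a)%:R :> int.
Proof.
move=> mM; rewrite (bigID (pred1 m)) /= [X in _ + X]big1.
  rewrite addr0; case: (boolP (m \in a)) => ma.
    rewrite (bigD1 m) /= ?mM ?ma ?eqxx // big1 ?addr0 // => x.
    by rewrite -!andbA => /and4P[_ _ ->].
  rewrite big1 // => x /andP[/andP[_ xa] /eqP xm].
  by rewrite -xm xa in ma.
by move=> x /andP[_ /negPf->].
Qed.

Lemma sum_in a c : c \subset M ->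
  \sum_(m' in M | m' \in a) (m' \in c)%:R = #|c :&: a|%:R :> int.
Proof.
move=> /subsetP cM; rewrite -sum1_card natr_sum.
rewrite [RHS]big_mkcond [LHS]big_mkcond /=; apply: eq_bigr => m _.
rewrite !inE; case: (boolP (m \in c)) => mc /=; last by rewrite if_same.
by rewrite (cM _ mc).
Qed.

Lemma row_value a r : is_row M C r -> \sum_(m in M | m \in a) rowAz r m =
  match r with
  | inl (inl m) => (m \in a)%:R
  | inl (inr m) => - (m \in a)%:R
  | inr (inl (c, m)) => (cover c \in a)%:R - (m \in a)%:R
  | inr (inr c) => #|c :&: a|%:R - (cover c \in a)%:R
  end :> int.
Proof.
case: r => [[m|m]|[[c m]|c]] /=.
- exact: sum_eq1.
- by move=> mM; rewrite sumrN sum_eq1.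
- case/andP=> cC mc; rewrite sumrB !sum_eq1 //; last exact: (cover_M linMC simMC cC).
  exact: (child_M linMC cC mc).
- move=> cC; rewrite sumrB sum_eq1 ?sum_in //; last exact: (cover_M linMC simMC cC).
  by apply/subsetP=> m; apply: (child_M linMC cC).
Qed.

(** Complementary slackness for the bounds 0 and 1 on a variable with weight [x] and value [b]. *)
Definition sign_ok (x : D) (b : bool) := (0 < x -> b) /\ (x < 0 -> ~~ b).

Lemma certified_sign a w :
  (forall m, m \in M -> sign_ok (w m) (m \in a)) -> certified a w.
Proof.
move=> sw; pose f x m := w x * (m == x)%:R.
apply: (@eq_certified _ (fun m => \sum_(x in M) f x m)) => [m mM|].
  rewrite (bigD1 m) //= /f eqxx mulr1 big1 ?addr0 // => x /andP[_ xm].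
  by rewrite eq_sym (negPf xm) mulr0.
apply: certified_sum => x xM; have [pos neg] := sw _ xM.
case: (leP 0 (w x)) => wx.
  apply: (@eq_certified _ (fun m => w x * (rowAz (inl (inl x)) m)%:~R)).
    by move=> m _; rewrite /f /=; case: eqP.
  apply: certified_row => // wx0; rewrite row_value //=.
  by rewrite pos // lt0r wx0.
apply: (@eq_certified _ (fun m => - w x * (rowAz (inl (inr x)) m)%:~R)).
  by move=> m _; rewrite /f /=; case: eqP; rewrite ?oppr0 ?mulr0 // mulrN mulNr opprK.
apply: certified_row => // [|_]; first by rewrite oppr_ge0 ltW.
by rewrite row_value //= (negPf (neg wx)).
Qed.

(** Here [l] multiplies the rows (ii) and [mu] the row (iii) of [c]. The weight left after
    subtracting these rows is handled by the bounds; the last two hypotheses say that the rows used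
    are tight at [a]. *)
Lemma certified_star a w c l (mu : D) : c \in C ->
  (forall m, m \in c -> 0 <= l m) -> 0 <= mu ->
  sign_ok (w (cover c) - \sum_(m in c) l m + mu) (cover c \in a) ->
  (forall m, m \in c -> sign_ok (w m + l m - mu) (m \in a)) ->
  (forall m, m \in M -> m != cover c -> m \notin c -> sign_ok (w m) (m \in a)) ->
  (forall m, m \in c -> l m != 0 -> (m \in a) -> (cover c \in a)) ->
  (mu != 0 -> (#|c| + (cover c \in a) <= #|c :&: a|.+1)%N) ->
  certified a w.
Proof.
move=> cC l0 mu0 swt swc swo tl tmu.
pose fl x m := l x * (rowAz (inr (inl (c, x))) m)%:~R.
pose fm m := mu * (rowAz (inr (inr c)) m)%:~R.
pose w' m := w m - (\sum_(x in c) fl x m + fm m).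
apply: (@eq_certified _ (fun m => w' m + (\sum_(x in c) fl x m + fm m))).
  by move=> m _; rewrite /w' subrK.
have ncc := cover_notin linMC simMC cC.
have cl : certified a (fun m => \sum_(x in c) fl x m).
  apply: certified_sum => x xc; apply: certified_row => [||lx]; first by rewrite /= cC.
    exact: l0.
  rewrite row_value /= ?cC //.
  have := tl _ xc lx; case: (x \in a) => [->//|_].
  by case: (_ \in a).
have cm : certified a fm.
  apply: certified_row => // mun0; rewrite row_value //=.
  rewrite lerBlDr addrAC lerBrDr -!natrD -[1]/1%:R -natrD ler_nat.
  by move: (tmu mun0); rewrite addn1.
apply: certifiedD (certifiedD cl cm); apply: certified_sign => m mM.
have w'E : w' m = if m == cover c then w m - \sum_(x in c) l x + mu else
                  if m \in c then w m + l m - mu else w m.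
  rewrite /w' /fm /fl /=; case: (eqVneq m (cover c)) => [->|mc].
    rewrite (negPf ncc) /= (eq_bigr l) => [|x xc].
      by rewrite sub0r mulrN1z mulrN1 opprD opprK addrA.
    by rewrite (_ : cover c == x = false) ?mulr1 //;
       apply: contraNF ncc => /eqP->.
  case: (boolP (m \in c)) => mc' /=.
    rewrite (bigD1 m) //= eqxx big1 => [|x /andP[_ xm]].
      by rewrite !sub0r !subr0 addr0 mulrN1z mulr1z mulrN1 mulr1 opprD opprK addrA.
    by rewrite eq_sym (negPf xm) subrr mulr0.
  rewrite big1 => [|x xc]; first by rewrite subrr mulr0 addr0 subr0.
  rewrite (_ : m == x = false) ?subrr ?mulr0 //.
  by apply: contraNF mc' => /eqP->.
rewrite w'E; case: eqP => [->//|/eqP mc]; case: (boolP (m \in c)) => mc'.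
  exact: swc.
exact: swo.
Qed.

(** An explicit optimal point and explicit multipliers in each case, according to the signs of the
    weights on [c] and on its resultant. *)
Lemma certified_single c w : c \in C ->
  exists2 a, solution [set c] a & certified a w.
Proof.
move=> cC; set t := cover c; have ntc : t \notin c := cover_notin linMC simMC cC.
have sol1 a : (t \in a) = (c \subset a) -> solution [set c] a.
  by move=> h; apply/solutionP=> d; rewrite inE => /eqP->.
pose up := c :|: (t |: [set m | 0 < w m]).
have upc : c \subset up by apply: subsetUl.
have upt : t \in up by rewrite !inE eqxx orbT.
have solup : solution [set c] up by apply: sol1; rewrite upt upc.
have upo m : m != t -> m \notin c -> sign_ok (w m) (m \in up).
  move=> mt mc; rewrite /sign_ok !inE (negPf mt) (negPf mc) /=.
  by split=> [->|/ltW]; rewrite ?leNgt.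
have upt1 (x : D) : 0 <= x -> sign_ok x true by move=> x0; split=> //; rewrite ltNge x0.
have upf1 (x : D) : x <= 0 -> sign_ok x false by move=> x0; split=> //; rewrite ltNge x0.
have [/forallP pos|] := boolP [forall m in c, 0 <= w m].
  have {}pos m : m \in c -> 0 <= w m by apply/implyP.
  have [wt0|wt0] := leP 0 (w t).
    exists up => //; apply: (@certified_star _ _ c (fun=> 0) 0) => //.
    - by rewrite big1 // upt subr0 addr0; apply: upt1.
    - move=> m mc; rewrite (subsetP upc) //; apply: upt1.
      by rewrite addr0 subr0 pos.
    - by move=> m _; apply: upo.
    - by rewrite eqxx.
  (* Now setting [t] to 1 costs [- w t], and avoiding this means giving up a child, at best the
     cheapest [m0]. In both cases [mu] is the smaller of the two prices. *)
  have [x xc] := constraint_ex linMC simMC cC.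
  case: (Order.TotalTheory.arg_minP w xc) => m0 m0c m0min {x xc}.
  have {}m0c : m0 \in c := m0c.
  have [wtm|wtm] := leP (- w m0) (w t).
    exists up => //; apply: (@certified_star _ _ c (fun=> 0) (- w t)) => //.
    - by rewrite oppr_ge0 ltW.
    - by rewrite big1 // upt subr0 subrr; apply: upt1.
    - move=> m mc; rewrite (subsetP upc) //; apply: upt1.
      rewrite addr0 opprK addrC -lerBlDr sub0r; apply: le_trans wtm.
      by rewrite lerN2 m0min.
    - by move=> m _; apply: upo.
    - by rewrite (setIidPl upc) upt addn1.
  pose a := (c :|: [set m | 0 < w m]) :\: [set m0; t].
  have ta : t \in a = false by rewrite !inE eqxx orbT.
  have m0a : m0 \in a = false by rewrite !inE eqxx.
  exists a.
    by apply: sol1; rewrite ta; apply/esym/negbTE/subsetPn; exists m0; rewrite ?m0a.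
  apply: (@certified_star _ _ c (fun=> 0) (w m0)) => //.
  - exact: pos.
  - rewrite big1 // ta; apply: upf1.
    by rewrite subr0 -lerBrDr sub0r ltW.
  - move=> m mc; have [->|mm0] := eqVneq m m0.
      by rewrite m0a addr0 subrr; apply: upf1.
    rewrite !inE (negPf mm0) mc /= (_ : m == t = false) /=.
      by apply: upt1; rewrite addr0 subr_ge0 m0min.
    by apply: contraNF ntc => /eqP<-.
  - move=> m _ mt mc; rewrite /sign_ok !inE (negPf mt) (negPf mc) orbF /=.
    have -> : m == m0 = false by apply: contraNF mc => /eqP->.
    by split=> [->|/ltW]; rewrite ?leNgt.
  - by rewrite eqxx.
  - move=> _; rewrite ta addn0.
    have -> : c :&: a = c :\ m0.
      apply/setP=> m; rewrite !inE; case: (boolP (m \in c)) => mc; rewrite ?andbF //=.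
      rewrite !andbT (_ : m == t = false) ?orbF //.
      by apply: contraNF ntc => /eqP<-.
    by rewrite [in X in (X <= _)%N](cardsD1 m0) m0c.
rewrite negb_forall => /existsP[m1]; rewrite negb_imply -ltNge => /andP[m1c wm1].
(* [N m] is the loss from setting the child [m] to 1; [t] is set to 1 when [w t] covers the total
   loss. *)
pose N m := Num.max 0 (- w m).
have N0 m : 0 <= N m by rewrite le_max lexx.
have [Nt|Nt] := leP (\sum_(m in c) N m) (w t).
  exists up => //; apply: (@certified_star _ _ c N 0) => //.
  - by rewrite upt addr0; apply: upt1; rewrite subr_ge0.
  - move=> m mc; rewrite (subsetP upc) //; apply: upt1.
    have : - w m <= N m by rewrite le_max lexx orbT.
    by rewrite subr0 addrC -lerBlDr sub0r.
  - by move=> m _; apply: upo.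
  - by rewrite eqxx.
(* Otherwise the reward for [t], cut off at 0, is spread over the children within their losses, so
   that no negative weight becomes positive. *)
have [||l lN lsum] := @split_amount _ _ c N (Num.max 0 (w t)) N0.
- by rewrite le_max lexx.
- by rewrite ge_max (ltW Nt) sumr_ge0.
have lneg m : 0 <= w m -> l m = 0.
  move=> wm; move: (lN m); rewrite /N (max_idPl _) ?oppr_le0 //.
  by rewrite andbC => /le_anti.
have lpos m : w m <= 0 -> l m <= - w m.
  by move=> wm; move: (lN m); rewrite /N (max_idPr _) ?oppr_ge0 // => /andP[].
pose a := [set m | 0 < w m] :\ t.
have ta : t \in a = false by rewrite !inE eqxx.
exists a.
  apply: sol1; rewrite ta; apply/esym/negbTE/subsetPn; exists m1 => //.
  by rewrite !inE (lt_gtF wm1) andbF.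
apply: (@certified_star _ _ c l 0) => //.
- by move=> m _; case/andP: (lN m).
- rewrite ta lsum; apply: upf1.
  by rewrite addr0 subr_le0 le_max lexx orbT.
- move=> m mc; rewrite !inE (_ : m == t = false) /=; last first.
    by apply: contraNF ntc => /eqP<-.
  have [wm|wm] := leP (w m) 0.
    by apply: upf1; rewrite subr0 addrC -lerBrDr sub0r lpos.
  by apply: upt1; rewrite lneg ?addr0 ?subr0 ltW.
- move=> m _ mt mc; rewrite /sign_ok !inE mt /=.
  by split=> [->|/ltW]; rewrite ?leNgt.
- move=> m mc lm; rewrite !inE => /andP[_ wm].
  by move: lm; rewrite lneg ?eqxx // ltW.
- by rewrite eqxx.
Qed.

Lemma eq_value_set w a a' :
  (forall m, m \in M -> w m != 0 -> (m \in a) = (m \in a')) ->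
  value w a = value w a'.
Proof.
move=> eqa; rewrite /value big_mkcondr [RHS]big_mkcondr; apply: eq_bigr => m mM.
by have [->|/(eqa _ mM)->] := eqVneq (w m) 0; rewrite ?if_same.
Qed.

Lemma value_point a v (x : D) : v \in M ->
  value (fun m => if m == v then x else 0) a = if v \in a then x else 0.
Proof.
move=> vM; rewrite /value big_mkcondr (bigD1 v) //= eqxx big1 ?addr0 // => m.
by case/andP=> _ /negPf->; rewrite if_same.
Qed.

(* The optimal value of the [K1]-part with the shared variable [v] fixed is an
   affine function of that variable; moving its slope to the other part makes
   the two parts independent. *)
Lemma certified_glue K1 K2 v : K1 \subset C -> v \in M ->
  (forall m, m \in nodes K1 -> m \in nodes K2 -> m = v) ->
  (forall w, exists2 a, solution K1 a & certified a w) ->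
  (forall w, exists2 a, solution K2 a & certified a w) ->
  forall w, exists2 a, solution (K1 :|: K2) a & certified a w.
Proof.
move=> K1C vM K12 cert1 cert2 w; pose N := nodes K1 :\ v.
pose w1 m := if m \in N then w m else 0.
(* [setT] and [set0] show that [v] can take both values; [set0] is a solution because constraints
   are nonempty. *)
have solT : solution K1 setT && (v \in setT).
  by rewrite inE andbT; apply/solutionP=> c _; rewrite subsetT inE.
have sol0 : solution K1 set0 && (v \notin set0).
  rewrite inE andbT; apply/solutionP=> c cK; rewrite inE subset0.
  have [m mc] := constraint_ex linMC simMC (subsetP K1C _ cK).
  by apply/esym/negbTE/set0Pn; exists m.
case: (@Order.TotalTheory.arg_maxP _ _ _ setT (fun a => solution K1 a && (v \in a))
  (value w1) solT) => a1 /andP[sa1 va1] max1.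
case: (@Order.TotalTheory.arg_maxP _ _ _ set0 (fun a => solution K1 a && (v \notin a))
  (value w1) sol0) => a0 /andP[sa0 va0] max0.
pose slope := value w1 a1 - value w1 a0.
pose w1' m := w1 m + (if m == v then - slope else 0).
have w1'E a : value w1' a = value w1 a - (if v \in a then slope else 0).
  by rewrite valueD value_point //; case: ifP; rewrite ?oppr0.
have [b sb cb] := cert1 w1'.
(* After the tilt by [slope] the best solutions with [v] at 1 and with [v] at 0 have equal value, so
   this part can follow whatever value [a2] gives to [v]. *)
have le_b : value w1' b <= value w1 a0.
  rewrite w1'E; case: ifPn => vb; last by rewrite subr0; apply: max0; rewrite sb.
  by rewrite lerBlDr /slope addrC subrK; apply: max1; rewrite sb.
have [a2 sa2 c2] := cert2 (fun m => w m - w1' m).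
have [a1' [sa1' va1' val1']] : exists a', [/\ solution K1 a',
    (v \in a') = (v \in a2) & value w1' a' = value w1 a0].
  case: (boolP (v \in a2)) => va2; [exists a1|exists a0]; split=> //.
  - by rewrite w1'E va1 /slope opprB addrC subrK.
  - exact/negbTE.
  - by rewrite w1'E (negPf va0) subr0.
(* The two points agree at [v]. As [w1'] vanishes outside [N] and [v], and [w - w1'] vanishes on
   [N], merging changes neither value. *)
pose a := (a1' :&: N) :|: (a2 :\: N).
have aN m : m \in nodes K1 -> (m \in a1') = (m \in a).
  move=> mK1; have mN : (m \in N) = (m != v) by rewrite /N in_setD1 mK1 andbT.
  rewrite in_setU in_setI [_ \in a2 :\: N]in_setD mN.
  by have [->|mv] := eqVneq m v; rewrite ?va1' ?andbF ?andbT ?orbF.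
have aN' m : m \notin N -> (m \in a2) = (m \in a).
  by move=> mN; rewrite in_setU in_setI [_ \in a2 :\: N]in_setD (negPf mN) andbF.
exists a.
  have s1 := eq_solution aN sa1'.
  have s2 : solution K2 a.
    apply: eq_solution sa2 => m mK2; apply: aN'; rewrite /N in_setD1 negb_and negbK.
    by case: (boolP (m \in nodes K1)) => [/K12/(_ mK2)->|_]; rewrite ?eqxx ?orbT.
  apply/solutionP=> c; rewrite inE => /orP[]; first by move/solutionP: s1; apply.
  by move/solutionP: s2; apply.
apply: (@eq_certified _ (fun m => w1' m + (w m - w1' m))) => [m _|].
  by rewrite addrC subrK.
apply: certifiedD.
  apply: certifiedW cb; apply: le_trans le_b _; rewrite -val1'.
  rewrite le_eqVlt (eq_value_set (a' := a)) ?eqxx // => m mM.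
  rewrite /w1' /w1; have [->|mv] := eqVneq m v.
    by move=> _; rewrite va1' aN' // !inE eqxx.
  by case: ifP => [|_]; rewrite ?addr0 ?eqxx // /N in_setD1 => /andP[_ /aN].
apply: certifiedW c2; rewrite le_eqVlt (eq_value_set (a' := a)) ?eqxx // => m mM.
case: (boolP (m \in N)) => [mN|/aN' //]; rewrite /w1' /w1 mN.
by move: mN; rewrite /N in_setD1 => /andP[/negPf-> _]; rewrite addr0 subrr eqxx.
Qed.

(** Take a constraint [c] and, after deleting it, the component [K2] of another constraint. By
    [star_separated] this component meets the star of [c] in at most one node, and the rest of [K]
    is glued to it there. *)
Lemma certified_forest T K w : acyclic_in (succ C T) ->
  K \subset constraints_below T -> exists2 a, solution K a & certified a w.
Proof.
move=> acyc; have [k] := ubnP #|K|; elim: k K w => // k IH K w; rewrite ltnS => cK KB.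
have KC : K \subset C.
  by apply: subset_trans KB _; apply/subsetP=> c; rewrite inE => /andP[].
have [K0|[c cK']] := set_0Vmem K.
  exists [set m | 0 < w m].
    by apply/solutionP=> c; rewrite K0 inE.
  apply: certified_sign => m _; rewrite /sign_ok inE.
  by split=> // /ltW; rewrite leNgt.
have cC : c \in C := subsetP KC _ cK'.
have [Kc|[d dK]] := set_0Vmem (K :\ c).
  have -> : K = [set c].
    by apply/eqP; rewrite eqEsubset sub1set cK' andbT -setD_eq0 Kc.
  exact: certified_single.
pose e := adjacent (K :\ c).
have csym : connect_sym e by apply/sym_connect_sym/adjacent_sym.
pose K2 := [set d' in K :\ c | connect e (cover d) (cover d')].
have reach d' m : d' \in K :\ c -> m \in cover d' |: d' -> connect e (cover d') m.
  move=> d'K; rewrite !inE => /orP[/eqP->|md'] //.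
  exact/connect1/adjacent_cover.
have [v [vc vd]] : exists v, v \in cover c |: c /\
    forall x, x \in cover c |: c -> connect e (cover d) x -> x = v.
  case: (boolP [exists v in cover c |: c, connect e (cover d) v]).
    case/existsP=> v /andP[vc dv]; exists v; split=> // x xc dx.
    apply: (star_separated acyc KB cK' xc vc); apply: connect_trans dv.
    by rewrite csym.
  (* If the component misses the star of [c], any node of the star can play the role of [v]. *)
  rewrite negb_exists => /forallP no; exists (cover c); split; first exact: setU11.
  by move=> x xc dx; move: (no x); rewrite xc dx.
have dK2 : d \in K2 by rewrite inE dK connect0.
have K2K : K2 \subset K :\ c by apply/subsetP=> x; rewrite inE => /andP[].
have cK2 : c \notin K2 by apply/negP=> /(subsetP K2K); rewrite !inE eqxx.
have K2K' : K2 \subset K := subset_trans K2K (subD1set _ _).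
have -> : K = (K :\: K2) :|: K2 by rewrite setUC -[K in LHS](setID K K2) (setIidPr K2K').
apply: (@certified_glue _ _ v).
- by apply: subset_trans KC; apply: subsetDl.
- move: vc; rewrite !inE => /orP[/eqP->|]; first exact: (cover_M linMC simMC cC).
  exact: (child_M linMC cC).
- move=> m /nodesP[d1 d1K md1] /nodesP[d2 d2K md2].
  move: (d2K); rewrite inE => /andP[d2c dd2].
  have dm : connect e (cover d) m.
    by apply: connect_trans dd2 _; apply: reach.
  have [d1c|d1c] := eqVneq d1 c; first by apply: vd => //; rewrite -d1c.
  move: d1K; rewrite !inE d1c /= andbC => /andP[d1K].
  rewrite d1K /= => /negP[]; apply: connect_trans dm _; rewrite csym.
  by apply: reach => //; rewrite !inE d1c.
- move=> w'; apply: IH; last by apply: subset_trans KB; apply: subsetDl.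
  apply: leq_trans cK; apply: proper_card; apply/properP; split.
    exact: subsetDl.
  by exists d; rewrite ?(subsetP K2K') // inE dK2.
- move=> w'; apply: IH; last exact: subset_trans KB.
  apply: leq_trans cK; apply: proper_card; apply/properP; split=> //.
  by exists c.
Qed.
End Certificates.
End Forest.

(** * Farkas' lemma and convex hulls *)

(* Bartl's induction: if [g <= 0] does not already follow from the first [k]
   forms, a witness [y] is normalised by [al k y = 1] and everything is
   restricted to the kernel of [al k] along [y]. *)
Lemma farkas (F : realFieldType) (J : finType) (k : nat) (al : nat -> J -> F)
    (g : J -> F) :
  (forall x : J -> F, (forall i, (i < k)%N -> \sum_j al i j * x j <= 0) ->
     \sum_j g j * x j <= 0) ->
  exists l : nat -> F, (forall i, 0 <= l i) /\
    forall j, g j = \sum_(i < k) l i * al i j.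
Proof.
elim: k al g => [|k IH] al g H.
  exists (fun=> 0); split=> // j; rewrite big_ord0.
  have /H g2 : forall i, (i < 0)%N -> \sum_j al i j * g j <= 0 by [].
  have : \sum_j g j * g j = 0.
    by apply/eqP; rewrite eq_le g2 sumr_ge0 // => i _; rewrite -expr2 sqr_ge0.
  move/psumr_eq0P => /(_ (fun i _ => sqr_ge0 (g i)) j isT) /eqP.
  by rewrite mulf_eq0 orbb => /eqP.
have [Hk|] := pselect (forall x, (forall i, (i < k)%N -> \sum_j al i j * x j <= 0) ->
     \sum_j g j * x j <= 0).
  have [l [l0 lg]] := IH al g Hk.
  exists (fun i => if (i < k)%N then l i else 0); split=> [i|j]; first by case: ifP.
  rewrite big_ord_recr /= ltnn mul0r addr0 lg.
  by apply: eq_bigr => i _; rewrite ltn_ord.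
case/existsNP=> y /not_implyP[aly /negP]; rewrite -ltNge => gy.
have aky : 0 < \sum_j al k j * y j.
  rewrite ltNge; apply: contraTN gy => aky; rewrite -leNgt; apply: H => i.
  by rewrite ltnS leq_eqVlt => /orP[/eqP-> //|/aly].
pose A i := (\sum_j al i j * y j) / (\sum_j al k j * y j).
pose G := (\sum_j g j * y j) / (\sum_j al k j * y j).
pose al' i j := al i j - A i * al k j.
pose g' j := g j - G * al k j.
(* Correcting a form by a multiple of [al k] is adjoint to projecting the vector along [y] onto the
   kernel of [al k]. *)
have shift (f : J -> F) x :
    \sum_j (f j - (\sum_j f j * y j) / (\sum_j al k j * y j) * al k j) * x j =
    \sum_j f j * (x j - (\sum_j al k j * x j) / (\sum_j al k j * y j) * y j).
  set P := \sum_j f j * y j; set Q := \sum_j al k j * y j.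
  set S := \sum_j al k j * x j.
  transitivity (\sum_j f j * x j - P / Q * S).
    by rewrite /S mulr_sumr -sumrB; apply: eq_bigr => j _; rewrite mulrBl mulrA.
  have -> : P / Q * S = S / Q * P by rewrite mulrC mulrA [RHS]mulrAC.
  by rewrite /P mulr_sumr -sumrB; apply: eq_bigr => j _; rewrite mulrBr mulrCA.
have [x alx|l [l0 lg]] := IH al' g'.
  rewrite /g' /G shift; apply: H => i; rewrite ltnS leq_eqVlt => /orP[/eqP->|ik].
    rewrite -shift divff ?gt_eqF // big1 // => j _.
    by rewrite mul1r subrr mul0r.
  by rewrite -shift; apply: alx.
have Ai i : (i < k)%N -> A i <= 0.
  by move=> ik; rewrite /A pmulr_lle0 ?invr_gt0 // aly.
(* The last coefficient collects all corrections by [al k]; it is nonnegative because [G] is and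
   every [A i] is at most 0. *)
exists (fun i => if (i < k)%N then l i else G - \sum_(i < k) l i * A i); split.
  move=> i; case: ifP => // _; rewrite subr_ge0; apply: (@le_trans _ _ 0).
    by apply: sumr_le0 => j _; rewrite mulr_ge0_le0 // Ai.
  by rewrite divr_ge0 // ltW.
move=> j; rewrite big_ord_recr /= ltnn.
rewrite (eq_bigr (fun i : 'I_k => l i * al i j)) => [|i _]; last by rewrite ltn_ord.
have /eqP := lg j; rewrite /g' subr_eq => /eqP->.
rewrite mulrBl mulr_suml addrCA addrC; congr (_ + _).
by rewrite -sumrB; apply: eq_bigr => i _; rewrite /al' mulrBr mulrA.
Qed.

(** Farkas' lemma with one extra coordinate, equal to 1 on all points, which makes the multipliers
    sum to 1. *)
Lemma conv_of_supports (R : realType) (n : nat) (s : seq (vec R n)) (z : vec R n) :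
  (forall w : vec R n, exists i : 'I_(size s),
     \sum_m w m * z m <= \sum_m w m * nth (fun=> 0) s i m) ->
  conv s z.
Proof.
move=> H.
pose al i (j : unit + {set 'I_n}) : R :=
  if j is inr m then nth (fun=> 0) s i m else 1.
pose g (j : unit + {set 'I_n}) : R := if j is inr m then z m else 1.
have [|l [l0 lg]] := @farkas R _ (size s) al g.
  move=> x alx; have [i zi] := H (fun m => x (inr m)).
  apply: le_trans (alx i (ltn_ord i)).
  rewrite !big_sumType /= lerD2l.
  by under eq_bigr do rewrite mulrC; under [leRHS]eq_bigr do rewrite mulrC.
exists (fun i => l i); split=> // [|m]; last exact: (lg (inr m)).
by rewrite [RHS](lg (inl tt)); apply: eq_bigr => i _; rewrite mulr1.
Qed.

(** * From acyclicity to integrality and total dual integrality *)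

Section Relaxation.
Variables (R : realType) (n : nat) (M : {set {set 'I_n}}).
Variables (C : {set {set {set 'I_n}}}) (T : {set {set 'I_n}}).
Hypothesis linMC : is_linearization M C.
Hypothesis simMC : is_simple M C.
Hypothesis TP : T \subset proper_monos M.
Implicit Types (c d : {set {set 'I_n}}) (m t u v : {set 'I_n}).
Implicit Types (a : {set {set 'I_n}}) (X : {set 'I_n}) (y z w : vec R n).

Let TM : T \subset M.
Proof. by apply: subset_trans TP _; apply: subsetDl. Qed.

Let I := singletons n :|: T.

Let IM : I \subset M.
Proof. by rewrite subUset TM andbT; case: linMC. Qed.

Lemma rowA_int (r : rowT n) m : rowA R r m = (rowAz r m)%:~R.
Proof.
by case: r => [[x|x]|[[c x]|c]] /=; rewrite ?intrB ?rmorphN /= ?natz.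
Qed.

Lemma rowb_int (r : rowT n) : rowb R r = (rowbz r)%:~R.
Proof. by case: r => [[x|x]|[[c x]|c]] //=; rewrite intrB natz. Qed.

Lemma sum_point y m : m \in M -> \sum_(x in M) (x == m)%:R * y x = y m.
Proof.
move=> mM; rewrite (bigD1 m) //= eqxx mul1r big1 ?addr0 // => x /andP[_ /negPf->].
by rewrite mul0r.
Qed.

Lemma sum_indicator y c : c \subset M ->
  \sum_(x in M) (x \in c)%:R * y x = \sum_(x in c) y x.
Proof.
move=> /subsetP cM; rewrite big_mkcond [RHS]big_mkcond; apply: eq_bigr => x _.
case: (boolP (x \in c)) => xc; last by rewrite mul0r if_same.
by rewrite cM // mul1r.
Qed.

Lemma constraint_sub c : c \in C -> c \subset M.
Proof. by move=> cC; apply/subsetP=> m; apply: (child_M linMC cC). Qed.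

Lemma feasibleP y : feasible M C y <->
  [/\ forall m, m \in M -> 0 <= y m <= 1,
      forall c m, c \in C -> m \in c -> y (cover c) <= y m &
      forall c, c \in C -> \sum_(m in c) y m <= y (cover c) + (#|c|%:R - 1)].
Proof.
have rowE r : is_row M C r -> \sum_(m in M) rowA R r m * y m =
    match r with
    | inl (inl m) => y m
    | inl (inr m) => - y m
    | inr (inl (c, m)) => y (cover c) - y m
    | inr (inr c) => \sum_(m in c) y m - y (cover c)
    end.
  case: r => [[m|m]|[[c m]|c]] /=.
  - exact: sum_point.
  - by move=> mM; under eq_bigr do rewrite mulNr; rewrite sumrN sum_point.
  - case/andP=> cC mc; under eq_bigr do rewrite mulrBl.
    rewrite sumrB !sum_point //; last exact: (cover_M linMC simMC cC).
    exact: (child_M linMC cC mc).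
  - move=> cC; under eq_bigr do rewrite mulrBl.
    rewrite sumrB sum_point ?sum_indicator //; first exact: constraint_sub.
    exact: (cover_M linMC simMC cC).
split=> [f|[f1 f2 f3] r rr]; last first.
  rewrite rowE //; case: r rr => [[m|m]|[[c m]|c]] /=.
  - by case/f1/andP.
  - by case/f1/andP=> + _; rewrite oppr_le0.
  - by case/andP=> cC mc; rewrite subr_le0 f2.
  - by move=> cC; rewrite lerBlDl f3.
split=> [m mM|c m cC mc|c cC].
- have := f (inl (inl m)) mM; have := f (inl (inr m)) mM.
  by rewrite !rowE //= oppr_le0 => -> ->.
- have rr : is_row M C (inr (inl (c, m))) by rewrite /= cC.
  by have := f _ rr; rewrite rowE //= subr_le0.
- by have := f (inr (inr c)) cC; rewrite rowE //= lerBlDl.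
Qed.

Lemma solution_feasible a : solution C a -> feasible M C (fun m => (m \in a)%:R : R).
Proof.
move=> /solutionP sa; apply/feasibleP; split=> [m _|c m cC mc|c cC].
- by case: (_ \in _); rewrite ?lexx ?ler01.
- by rewrite sa //; case: (boolP (c \subset a)) => [/subsetP/(_ _ mc)->|].
- have -> : \sum_(m in c) (m \in a)%:R = #|c :&: a|%:R :> R.
    rewrite -sum1_card natr_sum [RHS]big_mkcond [LHS]big_mkcond /=.
    by apply: eq_bigr => m _; rewrite inE; do 2!case: (_ \in _).
  rewrite sa //; case: (boolP (c \subset a)) => ca.
    by rewrite (setIidPl ca) addrC subrK.
  rewrite add0r lerBrDr natr1 ler_nat proper_card //.
  by rewrite properE subsetIl subsetI subxx.
Qed.

Lemma weak_duality a w y : certified M C a w -> feasible M C y ->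
  \sum_(m in M) w m * y m <= value M w a.
Proof.
move=> [u u0 [uA ub]] fy; apply: le_trans ub.
rewrite (eq_bigr (fun m => \sum_(r | is_row M C r) u r * (rowA R r m * y m))).
  rewrite exchange_big /=; apply: ler_sum => r rr; rewrite -mulr_sumr.
  by apply: ler_wpM2l => //; rewrite -rowb_int; apply: fy.
move=> m mM; rewrite -uA // mulr_suml; apply: eq_bigr => r _.
by rewrite rowA_int mulrA.
Qed.

Lemma feasible_conv (J : finType) (lam : J -> R) (f : J -> vec R n) :
  (forall j, 0 <= lam j) -> \sum_j lam j = 1 -> (forall j, feasible M C (f j)) ->
  feasible M C (fun m => \sum_j lam j * f j m).
Proof.
move=> lam0 lam1 ff r rr.
rewrite (eq_bigr (fun m => \sum_j lam j * (rowA R r m * f j m))) => [|m _].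
  rewrite exchange_big -[rowb R r]mul1r -lam1 mulr_suml; apply: ler_sum => j _.
  by rewrite -mulr_sumr ler_wpM2l // ff.
by rewrite mulr_sumr; apply: eq_bigr => j _; rewrite mulrCA.
Qed.

Lemma cover_subset c X : (cover c \subset X) = [forall m in c, m \subset X].
Proof.
apply/bigcupsP/forallP => [h m|h m mc]; first by apply/implyP=> /h.
by move: (h m); rewrite mc.
Qed.

Lemma monomial_solution X : solution C [set m in M | m \subset X].
Proof.
apply/solutionP=> c cC; rewrite inE (cover_M linMC simMC cC) cover_subset /=.
apply/forallP/subsetP => [h m mc|h m].
  by move: (h m); rewrite mc inE (child_M linMC cC mc).
by apply/implyP=> /h; rewrite inE => /andP[].
Qed.

Lemma monomial_ind (P : {set 'I_n} -> Prop) :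
  (forall i, P [set i]) ->
  (forall c, c \in C -> (forall m, m \in c -> P m) -> P (cover c)) ->
  forall m, m \in M -> P m.
Proof.
move=> P1 Pc m; have [k] := ubnP #|m|; elim: k m => // k IH m; rewrite ltnS => mk mM.
have [/imsetP[i _ ->]|mS] := boolP (m \in singletons n); first exact: P1.
have mP : m \in proper_monos M by rewrite inE mS.
have [c cC cm] := proper_ex linMC mP; rewrite -cm; apply: Pc => // m' m'c.
apply: IH; last exact: (child_M linMC cC m'c).
by apply: leq_trans mk; rewrite -cm (child_lt linMC simMC cC).
Qed.

(** The constraints below [T] force the product formula on the nodes below [T] only; elsewhere [a]
    is arbitrary apart from defining the singletons. *)
Lemma solution_monomials a m : solution (constraints_below C T) a -> m \in M ->
  m \in singletons n :|: succ C T -> (m \in a) = (m \subset [set i | [set i] \in a]).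
Proof.
move=> /solutionP sa; move: m; apply: monomial_ind => [i|c cC IH].
  by move=> _; rewrite sub1set inE.
rewrite inE => /orP[cS|cT].
  by move: (cover_proper linMC simMC cC); rewrite inE cS.
have cB : c \in constraints_below C T by rewrite inE cC.
rewrite sa // cover_subset.
have IHc m : m \in c -> (m \in a) = (m \subset [set i | [set i] \in a]).
  move=> mc; apply: IH => //; rewrite inE; apply/orP; right.
  by apply: succ_arc cT _; apply/arcP; exists c.
apply/subsetP/forallP => [h m|h m mc]; first by apply/implyP=> mc; rewrite -IHc ?h.
by rewrite IHc //; move: (h m); rewrite mc.
Qed.

(** With 0/1 members, row (ii) forces a resultant to 0 and row (iii) forces it to 1, as the product
    requires. *)
Lemma integral_monomials y X : feasible M C y ->
  (forall i, y [set i] = (i \in X)%:R) ->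
  forall m, m \in M -> y m = (m \subset X)%:R.
Proof.
move=> /feasibleP[f1 f2 f3] yX; apply: monomial_ind => [i|c cC IH].
  by rewrite yX sub1set.
have /andP[y0 y1] := f1 _ (cover_M linMC simMC cC).
apply/eqP; rewrite eq_le cover_subset.
have [/forallP h|] := boolP [forall m in c, m \subset X].
  rewrite y1 /= -(lerD2r (#|c|%:R - 1)); apply: le_trans (f3 _ cC).
  rewrite (eq_bigr (fun=> 1)) => [|m mc]; last first.
    by rewrite IH //; move: (h m); rewrite mc => /= ->.
  by rewrite sumr_const addrC subrK.
rewrite negb_forall => /existsP[m]; rewrite negb_imply => /andP[mc /negPf mX].
by rewrite y0 andbT; have := f2 _ _ cC mc; rewrite (IH _ mc) mX.
Qed.

Definition monomial_points : seq (vec R n) :=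
  [seq (fun m => ((m \in I) && (m \subset X))%:R) | X <- enum {set 'I_n}].

Lemma size_monomial_points : size monomial_points = size (enum {set 'I_n}).
Proof. by rewrite size_map. Qed.

(** Each monomial point lifts to a feasible one. Conversely, for every objective a certificate and
    weak duality bound a projected point by some monomial point. *)
Lemma acyclic_integral : acyclic_in M C (succ C T) ->
  integral_polytope (proj I (@PL R n M C)).
Proof.
move=> acyc; exists monomial_points.
have nthE (i : 'I_(size monomial_points)) m :
    nth (fun=> 0) monomial_points i m =
    ((m \in I) && (m \subset nth set0 (enum {set 'I_n}) i))%:R.
  by rewrite (nth_map set0) // -size_monomial_points.
split=> [i m|z]; first by rewrite nthE; case: (_ && _); [exists 1|exists 0].
split=> [[y [_ fy] zy]|[lam [lam0 lam1 zE]]]; last first.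
  exists (fun m => \sum_i lam i *
    (m \in [set m in M | m \subset nth set0 (enum {set 'I_n}) i])%:R).
    split; last first.
      by apply: feasible_conv => // i; apply/solution_feasible/monomial_solution.
    by move=> m mM; rewrite big1 // => i _; rewrite inE (negPf mM) mulr0.
  move=> m; rewrite zE; case: (boolP (m \in I)) => mI; last first.
    by rewrite big1 // => i _; rewrite nthE (negPf mI) mulr0.
  by apply: eq_bigr => i _; rewrite nthE mI inE (subsetP IM).
apply: conv_of_supports => w.
(* With no weight outside [I], it is harmless that the certified [a] may violate constraints not
   below [T]; it can be replaced by the monomial point of [X]. *)
pose w' m := if m \in I then w m else 0.
have [a sa ca] := certified_forest linMC simMC w' acyc (subxx _).
pose X := [set i | [set i] \in a].
have Xlt : (index X (enum {set 'I_n}) < size monomial_points)%N.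
  by rewrite size_monomial_points index_mem mem_enum.
exists (Ordinal Xlt); have := weak_duality ca fy.
have -> : \sum_(m in M) w' m * y m = \sum_m w m * z m.
  rewrite big_mkcond; apply: eq_bigr => m _; rewrite zy /w'.
  case: (boolP (m \in I)) => mI; last by rewrite mul0r mulr0 if_same.
  by rewrite (subsetP IM).
move/le_trans; apply; rewrite /value big_mkcondr big_mkcond le_eqVlt.
apply/orP; left; apply/eqP.
apply: eq_bigr => m _; rewrite nthE /= nth_index ?mem_enum // /w'.
case: (boolP (m \in I)) => mI; last by rewrite mulr0 !if_same.
rewrite (subsetP IM) // (solution_monomials sa) ?(subsetP IM) //.
  by rewrite -/X; case: (_ \subset _); rewrite ?mulr1 ?mulr0.
move: mI; rewrite !inE => /orP[->//|mT]; apply/orP; right.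
by apply/existsP; exists m; rewrite mT connect0.
Qed.

(** Now [a] satisfies all of [C], so it is feasible and its value bounds every dual solution from
    below; the certificate over [int] attains this bound. *)
Lemma acyclic_TDI : acyclic_in M C (succ C T) ->
  proper_monos M \subset succ C T -> TDI R M C.
Proof.
move=> acyc PT w obj dual_feas dual_obj _.
have CB : C \subset constraints_below C T.
  apply/subsetP=> c cC; rewrite inE cC (subsetP PT) //.
  exact: (cover_proper linMC simMC cC).
have [a sa [u u0 [uA ub]]] := certified_forest linMC simMC w acyc CB.
exists u; split; first split=> [r _|m mM]; first by rewrite ler0z.
  rewrite -uA // rmorph_sum; apply: eq_bigr => r _.
  by rewrite rowA_int intz -intrM.
move=> u' [u'0 u'A]; apply: (@le_trans _ _ (value M w a)%:~R).
  move: ub; rewrite -(ler_int R) rmorph_sum; congr (_ <= _).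
  by apply: eq_bigr => r _; rewrite rowb_int intz -intrM.
have /= fa := solution_feasible sa.
have -> : (value M w a)%:~R =
    \sum_(m in M) \sum_(r | is_row M C r) u' r * (rowA R r m * (m \in a)%:R).
  rewrite /value rmorph_sum big_mkcondr; apply: eq_bigr => m mM.
  under eq_bigr do rewrite mulrA; rewrite -mulr_suml u'A //.
  by case: (_ \in _); rewrite ?mulr1 ?mulr0.
rewrite exchange_big; apply: ler_sum => r rr; rewrite -mulr_sumr.
by apply: ler_wpM2l; [apply: u'0|apply: fa].
Qed.

(** * From integrality to the absence of linked children *)

(** The nonnegative terms [lam j * (g j - f j)] sum to zero. This carries an inequality tight at a
    convex combination over to each point of nonzero weight. *)
Lemma weighted_eq (J : finType) (lam f g : J -> R) :
  (forall j, 0 <= lam j) -> (forall j, f j <= g j) ->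
  \sum_j lam j * f j = \sum_j lam j * g j ->
  forall j, lam j != 0 -> f j = g j.
Proof.
move=> lam0 fg eqs j lamj.
have : \sum_j lam j * (g j - f j) = 0.
  by under eq_bigr do rewrite mulrBr; rewrite sumrB eqs subrr.
have ge0 i : true -> 0 <= lam i * (g i - f i) by rewrite mulr_ge0 // subr_ge0.
move/psumr_eq0P => /(_ ge0 j isT) /eqP.
by rewrite mulf_eq0 (negPf lamj) subr_eq0 => /eqP.
Qed.

(* The average of the 0/1 points of the full set and of the complement of [L],
   except that [x] and the monomials above it are set to 0. *)
Definition half_point (x : {set 'I_n}) (L : {set 'I_n}) : vec R n := fun m =>
  if m \notin M then 0 else if [disjoint m & L] then 1
  else if connect (arc C) m x then 0 else 2^-1.

(** Row (iii) asks the members of [c] to fall short of 1 by at least as much as the resultant does,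
    in total. A resultant at 1/2 has a member meeting [L], which falls short by at least 1/2. *)
Lemma half_point_feasible (x L a b : {set 'I_n}) i j :
  arc C x a -> arc C x b -> a != b -> i \in a -> i \in L -> j \in b -> j \in L ->
  PL M C (half_point x L).
Proof.
move=> xa xb ab ia iL jb jL.
have half01 : 0 <= (2^-1 : R) <= 1 by rewrite invr_ge0 ler0n invf_le1 ?ler1n ?ltr0n.
have yE m : m \in M -> half_point x L m = if [disjoint m & L] then 1
  else if connect (arc C) m x then 0 else 2^-1.
  by rewrite /half_point => ->.
have y01 m : 0 <= half_point x L m <= 1.
  by rewrite /half_point; do 3?[case: ifP => _]; rewrite ?lexx ?ler01.
split; first by move=> m mM; rewrite /half_point mM.
apply/feasibleP; split=> [m _|c m cC mc|c cC]; first exact: y01.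
  have cM := cover_M linMC simMC cC; have mM := child_M linMC cC mc.
  have cm : arc C (cover c) m by apply/arcP; exists c.
  rewrite (yE _ cM) (yE _ mM); case: ifPn => cL.
    by rewrite (disjointWl (arc_sub cm) cL).
  case: ifPn => cx.
    by case: ifP => _; rewrite ?ler01 //; case: ifP; case/andP: half01.
  rewrite (negPf (contraNN (fun mx => connect_trans (connect1 cm) mx) cx)).
  by case: ifP => _ //; case/andP: half01.
have cM := cover_M linMC simMC cC; rewrite (yE _ cM).
have cle1 (A : {set {set 'I_n}}) : \sum_(m in A) half_point x L m <= #|A|%:R.
  rewrite -sum1_card natr_sum; apply: ler_sum => m _.
  by case/andP: (y01 m).
have drop m : m \in c -> \sum_(m in c) half_point x L m <=
    half_point x L m + (#|c|%:R - 1).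
  move=> mc; rewrite (big_setD1 m) //= lerD2l; apply: le_trans (cle1 _) _.
  by rewrite (cardsD1 m c) mc natrD addrAC subrr add0r.
case: ifPn => cL; first by rewrite addrC subrK.
case: ifPn => cx; last first.
  have [k kc kL] : exists2 k, k \in cover c & k \in L.
    by move: cL; rewrite -setI_eq0 => /set0Pn[k]; rewrite inE => /andP[]; exists k.
  case/bigcupP: kc => m mc km; apply: le_trans (drop _ mc) _; rewrite lerD2r.
  rewrite (yE _ (child_M linMC cC mc)) ifF; first by case: ifP => _; case/andP: half01.
  by apply/negP=> /disjointFr/(_ km); rewrite kL.
(* A resultant at 0 needs a total shortfall of 1: for [x] itself the children [a] and [b] give 1/2
   each, and strictly above [x] a member leading to [x] is 0. *)
rewrite add0r; have [cE|[m cm mx]] := connect_first cx.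
  have half_child m k : arc C x m -> k \in m -> k \in L -> half_point x L m = 2^-1.
    move=> xm km kL; rewrite (yE _ (arc_Mr linMC xm)) ifF.
      by rewrite (negPf (arc_irrefl_connect linMC simMC xm)).
    by apply/negP=> /disjointFr/(_ km); rewrite kL.
  have ac := arc_mem linMC simMC cC cE xa; have bc := arc_mem linMC simMC cC cE xb.
  rewrite (big_setD1 a) //= (big_setD1 b) /=; last by rewrite !inE eq_sym ab.
  rewrite (half_child _ _ xa ia iL) (half_child _ _ xb jb jL) addrA.
  have := cle1 ((c :\ a) :\ b); rewrite (cardsD1 a c) ac.
  rewrite [#|c :\ a|](cardsD1 b) in_setD1 eq_sym ab bc !natrD.
  set S := (\sum_(m in _) _); set N : R := #|_|%:R => SN.
  have -> : (2^-1 : R) + 2^-1 = 1 by rewrite [RHS]splitr mul1r.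
  by rewrite addrAC subrr add0r lerD2l.
have mc := arc_mem linMC simMC cC erefl cm.
apply: le_trans (drop _ mc) _; rewrite (yE _ (child_M linMC cC mc)) mx ifF ?add0r //.
have ix : i \in x := subsetP (arc_sub xa) _ ia.
have im : i \in m := subsetP (connect_sub_mono mx) _ ix.
by apply/negP=> /disjointFr/(_ im); rewrite iL.
Qed.

Lemma integral_unlinked : integral_polytope (proj I (@PL R n M C)) ->
  forall x, x \in succ C T -> ~ linked_children C T x.
Proof.
case=> s [int_s convE] x xT [a [b [i [j [[xa xb ab ia jb] ij]]]]].
pose L := [set k | connect (link (avoiding C T x)) i k].
have iL : i \in L by rewrite inE connect0.
have jL : j \in L by rewrite inE.
have PLy := half_point_feasible xa xb ab ia iL jb jL.
set y := half_point x L in PLy.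
have [lam [lam0 lam1 zE]] : conv s (fun m => if m \in I then y m else 0).
  by apply/convE; exists y.
(* Unit weights put each listed point into the polytope. Its singleton coordinates are integers
   between 0 and 1, so it is a monomial point. *)
have sP (k : 'I_(size s)) : exists X : {set 'I_n},
    forall m, m \in I -> nth (fun=> 0) s k m = (m \subset X)%:R.
  have [yk [_ fk] yE] : proj I (PL M C) (nth (fun=> 0) s k).
    apply/convE; exists (fun k' => (k' == k)%:R); split.
    - by move=> k'; rewrite ler0n.
    - by rewrite (bigD1 k) //= eqxx big1 ?addr0 // => k' /negPf->.
    - move=> m; rewrite (bigD1 k) //= eqxx mul1r big1 ?addr0 // => k' /negPf->.
      by rewrite mul0r.
  have SI l : [set l] \in I by rewrite inE imset_f.
  exists [set l | nth (fun=> 0) s k [set l] == 1] => m mI.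
  rewrite yE mI; apply: integral_monomials (subsetP IM _ mI) => // l.
  have /feasibleP[f1 _ _] := fk; have := f1 _ (singleton_M linMC l).
  have [p] := int_s k [set l]; rewrite inE yE SI => ->.
  rewrite ler0z (ler_int R p 1) => /andP[].
  by case: p => [[|[|p]]|p] //=; rewrite ?eqxx // eq_sym oner_eq0.
have [X sX] := boolp.choice sP.
have {}zE m : m \in I -> y m = \sum_k lam k * (m \subset X k)%:R.
  by move=> mI; have := zE m; rewrite mI => ->; apply: eq_bigr => k _; rewrite sX.
have SI l : [set l] \in I by rewrite inE imset_f.
have TI t : t \in T -> t \in I by rewrite inE orbC => ->.
(* A singleton is never above [x], since [x] is larger than its nonempty child [a]. *)
have yS l : y [set l] = if l \in L then 2^-1 else 1.
  rewrite /y /half_point (singleton_M linMC) /= disjoints1.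
  case: (boolP (l \in L)) => //= lL; rewrite ifF //; apply/negP=> /connect_sub_mono xl.
  have := arc_lt linMC simMC xa; have := subset_leq_card xl; rewrite cards1.
  have := mono_neq0 linMC (arc_Mr linMC xa); rewrite -card_gt0.
  by case: #|a| => // p _ x1 x2; have := leq_trans x2 x1.
have yT t k : t \in T -> ~~ connect (arc C) t x -> k \in t -> k \in L -> y t = 2^-1.
  move=> tT tx kt kL; rewrite /y /half_point (subsetP TM) //= ifF.
    by rewrite (negPf tx).
  by apply/negP=> /disjointFr/(_ kt); rewrite kL.
have offL k l : lam k != 0 -> l \notin L -> l \in X k.
  move=> lamk lL; pose f k := ([set l] \subset X k)%:R : R.
  have f1 k' : f k' <= 1 by rewrite /f; case: (_ \subset _).
  have sumE : \sum_k lam k * f k = \sum_k lam k * 1.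
    by rewrite -zE // yS (negPf lL) -mulr_suml lam1 mulr1.
  have := weighted_eq lam0 f1 sumE lamk; rewrite /f sub1set.
  by case: (l \in X k) => // /eqP; rewrite eq_sym oner_eq0.
(* [t] and its element [l] both have value 1/2, so the valid inequality between them is tight. *)
have onL k l t : lam k != 0 -> l \in L -> l \in X k ->
    t \in avoiding C T x -> l \in t -> t \subset X k.
  move=> lamk lL lX; rewrite inE => /andP[tT tx] lt.
  pose f k := (t \subset X k)%:R : R; pose g k := ([set l] \subset X k)%:R : R.
  have fg k' : f k' <= g k'.
    rewrite /f /g sub1set ler_nat.
    by case: (boolP (t \subset X k')) => [/subsetP/(_ _ lt)->|].
  have sumE : \sum_k lam k * f k = \sum_k lam k * g k.
    by rewrite /f /g -zE ?TI // -zE // yS lL (yT _ _ tT tx lt lL).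
  have := weighted_eq lam0 fg sumE lamk; rewrite /f /g sub1set lX.
  by case: (t \subset X k) => // /eqP; rewrite eq_sym oner_eq0.
(* Since [i] has value 1/2, some point of nonzero weight contains it; the links then spread
   membership to all of [L], and so to a [t] above [x], whose value is 0. *)
have [k lamk iX] : exists2 k, lam k != 0 & i \in X k.
  have [/existsP[k /andP[]]|] := boolP [exists k, (lam k != 0) && (i \in X k)].
    by exists k.
  rewrite negb_exists => /forallP no; have := zE _ (SI i); rewrite yS iL big1.
    by move/eqP; rewrite invr_eq0 pnatr_eq0.
  move=> k _; move: (no k); rewrite sub1set negb_and negbK.
  by case/orP=> [/eqP->|/negPf->]; rewrite ?mul0r ?mulr0.
have LX l : l \in L -> l \in X k.
  rewrite inE => il; pose P : pred 'I_n := fun l => (l \in L) && (l \in X k).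
  suff /andP[] : P l by [].
  have Pi : P i by rewrite /P iL.
  apply: connect_closed il Pi => p q pq /andP[pL pX].
  have /linkP[t [tA pt qt]] := pq.
  rewrite /P (subsetP (onL _ _ _ lamk pL pX tA pt)) // andbT.
  by move: pL; rewrite !inE => pL; apply: connect_trans pL (connect1 pq).
have /succP[t tT tx] := xT.
have tX : t \subset X k.
  by apply/subsetP=> l _; case: (boolP (l \in L)) => [/LX|/offL]; last exact.
have it : i \in t.
  exact: (subsetP (connect_sub_mono tx)) (subsetP (arc_sub xa) _ ia).
have yt : y t = 0.
  rewrite /y /half_point (subsetP TM) //= tx ifF //.
  by apply/negP=> /disjointFr/(_ it); rewrite iL.
pose f k := (t \subset X k)%:R : R.
have f0 k' : 0 <= f k' by rewrite ler0n.
have sumE : \sum_k lam k * 0 = \sum_k lam k * f k.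
  by rewrite -zE ?TI // yt big1 // => ? _; rewrite mulr0.
have /eqP := weighted_eq lam0 f0 sumE lamk.
by rewrite /f tX eq_sym oner_eq0.
Qed.

End Relaxation.

Theorem theorem3p6 (R : realType) (n : nat) (M : {set {set 'I_n}})
    (C : {set {set {set 'I_n}}}) (T : {set {set 'I_n}}) :
  (0 < n)%N ->
  is_linearization M C ->
  is_simple M C ->
  T \subset proper_monos M ->
  (integral_polytope (proj (singletons n :|: T) (@PL R n M C)) <->
     ~ (exists (VZ : {set {set 'I_n}}) (AZ : rel {set 'I_n}),
          [/\ is_subgraph M C VZ AZ, underlying_is_cycle VZ AZ &
              VZ \subset succ C T]))
  /\
  (integral_polytope (proj (singletons n :|: T) (@PL R n M C)) ->
     proper_monos M \subset succ C T ->
     @TDI R n M C).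
Proof.
move=> _ lin sim TP.
have acyc : integral_polytope (proj (singletons n :|: T) (@PL R n M C)) ->
    acyclic_in M C (succ C T).
  move=> int [VZ [AZ [sub cyc]]]; apply/negP.
  have TM : T \subset M by apply: subset_trans TP _; apply: subsetDl.
  exact: (unlinked_acyclic lin sim TM (integral_unlinked lin sim TP int) sub cyc).
split; first by split=> //; apply: acyclic_integral.
by move=> /acyc; apply: acyclic_TDI.
Qed.
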